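(* Let $n\ge 1$, let $\eta$ be a partition of $n$, and let $A$ be an $n\times n$ complex matrix. Then $$\operatorname{trace}\bigl(E_A^n\big|_{M_\eta(0)}\bigr)=\hat d_\eta(A).$$
   Context: Let $v_1,\dots,v_n$ be the standard orthonormal basis of $\mathbb{C}^n$. An $n\times n$ matrix $B$ acts diagonally on $(\mathbb{C}^n)^{\otimes n}$ by $B^{\otimes n}(v_{i_1}\otimes\cdots\otimes v_{i_n})=Bv_{i_1}\otimes\cdots\otimes Bv_{i_n}$. Let $du$ be the normalized Haar measure on the unitary group $U_n$ and write $A^u=uAu^{*}$ for $u\in U_n$. Define the operator $$E_A^n=\int_{U_n}(A^u)^{\otimes n}\,du$$ on $(\mathbb{C}^n)^{\otimes n}$. For a partition $\eta$ of $n$, $\chi_\eta$ is the irreducible character of $S_n$ indexed by $\eta$ (with $\chi_{(n)}$ trivial), and $M_\eta\subseteq(\mathbb{C}^n)^{\otimes n}$ is an irreducible $U_n$-submodule (equivalently $GL_n(\mathbb{C})$-submodule) of the type indexed by $\eta$ (highest weight $\eta$). The zero weight space of $(\mathbb{C}^n)^{\otimes n}$ is the span of the tensors $v_{\sigma(1)}\otimes\cdots\otimes v_{\sigma(n)}$, $\sigma\in S_n$ (each basis vector occurs exactly once), and $M_\eta(0)$ is the intersection of $M_\eta$ with this zero weight space. The operator $E_A^n$ maps $M_\eta(0)$ into itself, so the trace is defined. The immanant is $d_\eta(A)=\sum_{\sigma\in S_n}\chi_\eta(\sigma)\prod_{i=1}^nA_{i\,\sigma(i)}$, and $\hat d_\eta(A)=\int_{U_n}d_\eta(A^u)\,du$.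 *)

(* Defs.v *)
From HB Require Import structures.
From mathcomp Require Import all_boot all_order all_fingroup all_algebra.
From mathcomp Require Import complex.
From mathcomp Require Import all_classical all_reals all_analysis.

Set Implicit Arguments.
Unset Strict Implicit.
Unset Printing Implicit Defensive.

Import Order.TTheory GRing.Theory Num.Theory.
Import numFieldNormedType.Exports.

Local Open Scope classical_set_scope.
Local Open Scope ring_scope.
Local Open Scope sesquilinear_scope.
Local Open Scope complex_scope.

(* [f] is an arbitrary map; this is the trace of the restriction of [f] to [U]
   when [f] is linear and maps [U] into itself. *)
Definition trace_on (F : fieldType) (V : vectType F) (U : {vspace V})
    (f : V -> V) : F :=
  \sum_(i < \dim U) coord (vbasis U) i (f (vbasis U)`_i).

Definition is_partition (n : nat) (eta : seq nat) : bool :=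
  [&& sorted geq eta, 0%N \notin eta & sumn eta == n].

Section SymmetricGroupCharacters.

Variables (F : fieldType) (n : nat) (eta : seq nat).

(* The cells of the Young diagram of [eta] are filled with 0, ..., n - 1 row by
   row, so that [i] lies in row [reshape_index eta i] and in column
   [reshape_offset eta i]. *)
Definition row_stab : {set 'S_n} :=
  [set s : 'S_n | [forall i, reshape_index eta (s i) == reshape_index eta i]].

Definition col_stab : {set 'S_n} :=
  [set s : 'S_n | [forall i, reshape_offset eta (s i) == reshape_offset eta i]].

(* A function [x] on 'S_n stands for the element \sum_s x s *: s of the group
   algebra. *)
Definition group_alg := {ffun 'S_n -> F^o}.

Definition left_mul (s : 'S_n) (x : group_alg) : group_alg :=
  [ffun t : 'S_n => x (s^-1 * t)%g].

Definition young_symmetrizer : group_alg :=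
  [ffun t : 'S_n =>
     \sum_(p in row_stab) \sum_(q in col_stab | (p * q)%g == t) (-1) ^+ q].

(* The left ideal generated by the Young symmetrizer. *)
Definition specht : {vspace group_alg} :=
  <<[seq left_mul s young_symmetrizer | s : 'S_n]>>%VS.

(* The character of the Specht module. The product of 'S_n composes from left to
   right; with the opposite convention the value at [s] would be the one at
   s^-1, which is the same because s and s^-1 are conjugate. *)
Definition chi (s : 'S_n) : F := trace_on specht (left_mul s).

Definition immanant (A : 'M[F]_n) : F :=
  \sum_(s : 'S_n) chi s * \prod_(i < n) A i (s i).

End SymmetricGroupCharacters.

Section TensorPower.

Variables (C : numClosedFieldType) (n : nat).

(* The n-th tensor power of C^n: [t i] is the coefficient of [t] on
   v_{i 0} (x) ... (x) v_{i (n-1)}. *)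
Definition tensor := {ffun {ffun 'I_n -> 'I_n} -> C^o}.

Definition pure_tensor (x : 'I_n -> 'cV[C]_n) : tensor :=
  [ffun i : {ffun 'I_n -> 'I_n} => \prod_(k < n) x k (i k) 0].

Definition basis_vec (j : 'I_n) : 'cV[C]_n := delta_mx j 0.

Definition tpow_coef (B : 'M[C]_n) (i j : {ffun 'I_n -> 'I_n}) : C :=
  \prod_(k < n) B (i k) (j k).

Definition tpow (B : 'M[C]_n) (t : tensor) : tensor :=
  [ffun i => \sum_j tpow_coef B i j * t j].

Lemma tpow_pure (B : 'M[C]_n) (x : 'I_n -> 'cV[C]_n) :
  tpow B (pure_tensor x) = pure_tensor (fun k => B *m x k).
Proof.
apply/ffunP => i; rewrite !ffunE.
under [RHS]eq_bigr => k _ do rewrite mxE.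
rewrite bigA_distr_bigA /=; apply: eq_bigr => j _.
by rewrite ffunE -big_split.
Qed.

Definition zero_weight : {vspace tensor} :=
  <<[seq pure_tensor (fun k => basis_vec (s k)) | s : 'S_n]>>%VS.

Definition unitary_stable (M : {vspace tensor}) : Prop :=
  forall u : 'M[C]_n, u \is unitarymx ->
  forall t : tensor, t \in M -> tpow u t \in M.

Definition irreducible_submodule (M : {vspace tensor}) : Prop :=
  [/\ M != 0%VS, unitary_stable M &
      forall N : {vspace tensor}, (N <= M)%VS -> unitary_stable N ->
        N = 0%VS \/ N = M].

(* [M] contains a nonzero vector on which the Borel subgroup of upper triangular
   invertible matrices acts through the character
   g |-> \prod_i g i i ^+ eta_i. *)
Definition has_highest_weight (eta : seq nat) (M : {vspace tensor}) : Prop :=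
  exists w : tensor, [/\ w \in M, w != 0 &
    forall g : 'M[C]_n, g \in unitmx ->
      (forall i j : 'I_n, (j < i)%N -> g i j = 0) ->
      tpow g w = (\prod_(i < n) g i i ^+ nth 0%N eta i) *: w].

Definition conj_by (A u : 'M[C]_n) : 'M[C]_n := u *m A *m u^t*.

End TensorPower.

Section HaarMeasure.

Variables (R : realType) (n : nat).

(* The alias R[i]^o carries the topology given by the complex modulus. *)
Record unitary := Unitary {
  unitary_val :> 'M[R[i]^o]_n;
  unitary_valP : (unitary_val : 'M[R[i]]_n) \is unitarymx
}.

HB.instance Definition _ := [isSub for unitary_val].
HB.instance Definition _ := [Choice of unitary by <:].

Fact unitary1_subproof : (1%:M : 'M[R[i]]_n) \is unitarymx.
Proof. by apply/unitarymxP; rewrite trmx1 map_mx1 mulmx1. Qed.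

Definition unitary1 : unitary := Unitary unitary1_subproof.

HB.instance Definition _ := isPointed.Build unitary unitary1.

Fact unitary_mul_subproof (g u : unitary) :
  ((g : 'M[R[i]]_n) *m (u : 'M[R[i]]_n)) \is unitarymx.
Proof. exact: mul_unitarymx (unitary_valP g) (unitary_valP u). Qed.

Definition unitary_mul (g u : unitary) : unitary :=
  Unitary (unitary_mul_subproof g u).

(* The unitary group with the sigma-algebra generated by the open sets of the
   topology induced from the space of matrices. *)
Definition unitary_borel :=
  g_sigma_algebraType (@open (initial_topology unitary_val)).

(* Being a probability, [mu] is normalized. *)
Definition is_haar (mu : probability unitary_borel R) : Prop :=
  forall (g : unitary) (S : set unitary_borel), measurable S ->
    mu (unitary_mul g @^-1` S) = mu S.

Definition integralC (mu : probability unitary_borel R)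
    (f : unitary -> R[i]) : R[i] :=
  Rintegral mu setT (fun u => complex.Re (f u)) +i*
  Rintegral mu setT (fun u => complex.Im (f u)).

Definition averaged_tpow (mu : probability unitary_borel R) (A : 'M[R[i]]_n)
    (t : tensor R[i] n) : tensor R[i] n :=
  [ffun i => \sum_j integralC mu (fun u => tpow_coef (conj_by A u) i j) * t j].

Definition averaged_immanant (mu : probability unitary_borel R) (eta : seq nat)
    (A : 'M[R[i]]_n) : R[i] :=
  integralC mu (fun u => immanant eta (conj_by A u)).

End HaarMeasure.

(* Main.v *)
(** Identify the zero weight space with the group algebra of S_n. The zero weight
    part of the action of a matrix B is then the group algebra element
    sum_s (prod_k B_{k, s k}) s, and translating the Haar integral by diagonal
    sign matrices shows that E_A^n maps the zero weight space into itself. Hence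
    the trace of E_A^n on M(0) is the sum over s of the average of
    prod_k A^u_{k, s k} times the trace of s on M(0), and the point is that
    M(0) affords the character chi_eta.

    A U_n-submodule M is stable under all matrices, and its irreducibility makes
    M(0) a simple S_n-module. Merging the basis vectors along the rows of the
    diagram turns a highest weight vector into a nonzero element z of M(0) that
    is fixed by the row stabilizer and satisfies relations coming from the
    raising operators. These relations imply that the column antisymmetrizer b
    does not kill z: removing the cells from the antisymmetrizer one at a time
    only costs nonzero factors, the hook lengths. For c = ab the Young
    symmetrizer, positivity of x^* x then gives cz <> 0, and von Neumann's lemma
    (a x b is a multiple of c) makes x |-> x z an isomorphism from the Specht
    module onto M(0). *)
From HB Require Import structures.
Require Import Defs.
From mathcomp Require Import all_boot all_order all_fingroup all_algebra.
From mathcomp Require Import ring complex.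
From mathcomp Require Import all_classical all_reals all_analysis.
From mathcomp Require Import measurable_realfun.

Set Implicit Arguments.
Unset Strict Implicit.
Unset Printing Implicit Defensive.

Import Order.TTheory GRing.Theory Num.Theory.
Import numFieldNormedType.Exports.

Local Open Scope ring_scope.
Local Open Scope sesquilinear_scope.

(** * Traces and the group algebra of the symmetric group *)

(** The chosen basis of [phi @: U] need not be the image of that of [U]. Lifting its vectors to
    [g j] in [U], both traces expand to the same double sum, as in tr(PQ) = tr(QP). *)
Lemma trace_on_lfun_iso (F : fieldType) (V V' : vectType F) (U : {vspace V})
    (phi : 'Hom(V, V')) (f : 'End(V)) (f' : V' -> V') :
  (U :&: lker phi = 0)%VS -> {in U, forall u, f u \in U} ->
  {in U, forall u, f' (phi u) = phi (f u)} ->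
  trace_on (phi @: U)%VS f' = trace_on U f.
Proof.
move=> injphi fU ff'; rewrite /trace_on.
set X := vbasis U; set Y := vbasis (phi @: U)%VS.
have Xin (i : 'I_(\dim U)) : X`_i \in U by rewrite vbasis_mem ?mem_nth ?size_tuple.
have /fin_all_exists2[g gU gY] (j : 'I_(\dim (phi @: U))) :
    exists2 u, u \in U & Y`_j = phi u.
  by apply/memv_imgP; rewrite vbasis_mem ?mem_nth ?size_tuple.
have gsum v : v \in U -> v = \sum_j coord Y j (phi v) *: g j.
  move=> vU; apply/eqP; rewrite -subr_eq0 -memv0 -injphi memv_cap.
  rewrite memvB ?memv_suml//=; last by move=> j _; rewrite memvZ.
  rewrite memv_ker linearB /= linear_sum /= subr_eq0 eq_sym; apply/eqP.
  under eq_bigr do rewrite linearZ /= -gY.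
  by rewrite -coord_vbasis // memv_img.
have gX j : g j = \sum_i coord X i (g j) *: X`_i by rewrite -coord_vbasis.
transitivity (\sum_j \sum_i coord X i (g j) * coord Y j (phi (f X`_i))).
  apply: eq_bigr => j _; rewrite gY ff' // {1}gX !linear_sum.
  by apply: eq_bigr => i _; rewrite !linearZ.
rewrite exchange_big /=; apply: eq_bigr => i _.
rewrite {2}[f X`_i]gsum ?fU // linear_sum /=.
by apply: eq_bigr => j _; rewrite linearZ /= mulrC.
Qed.

Lemma trace_on_suml (F : fieldType) (V : vectType F) (U : {vspace V})
    (I : finType) (k : I -> F) (f : I -> V -> V) :
  trace_on U (fun v => \sum_i k i *: f i v) = \sum_i k i * trace_on U (f i).
Proof.
rewrite /trace_on; under eq_bigr do rewrite linear_sum /=.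
rewrite exchange_big; apply: eq_bigr => i _; rewrite mulr_sumr.
by apply: eq_bigr => j _; rewrite linearZ.
Qed.

Lemma eq_in_trace_on (F : fieldType) (V : vectType F) (U : {vspace V})
    (f g : V -> V) : {in U, f =1 g} -> trace_on U f = trace_on U g.
Proof.
move=> fg; apply: eq_bigr => i _; congr (coord _ _ _); apply: fg.
by rewrite vbasis_mem ?mem_nth ?size_tuple.
Qed.

Section GroupAlgebra.

Variables (F : fieldType) (n : nat).
Implicit Types (s t : 'S_n) (x y z : group_alg F n).

Lemma left_mul_is_linear s : linear (@left_mul F n s).
Proof. by move=> k x y; apply/ffunP => t; rewrite !ffunE. Qed.

HB.instance Definition _ s :=
  GRing.isLinear.Build F (group_alg F n) (group_alg F n) *:%R (@left_mul F n s)
    (left_mul_is_linear s).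

Lemma left_mul1 x : left_mul 1 x = x.
Proof. by apply/ffunP => t; rewrite !ffunE invg1 mul1g. Qed.

Lemma left_mulM s t x : left_mul s (left_mul t x) = left_mul (s * t) x.
Proof. by apply/ffunP => u; rewrite !ffunE invMg mulgA. Qed.

Definition ga_mul x y : group_alg F n := \sum_s x s *: left_mul s y.

Lemma ga_mulE x y t : ga_mul x y t = \sum_s x s * y (s^-1 * t)%g.
Proof. by rewrite sum_ffunE; apply: eq_bigr => s _; rewrite !ffunE. Qed.

Lemma ga_mul_is_linear x : linear (ga_mul x).
Proof.
move=> k y z; rewrite /ga_mul scaler_sumr -big_split /=.
by apply: eq_bigr => s _; rewrite linearP scalerDr scalerA mulrC -scalerA.
Qed.

HB.instance Definition _ x :=
  GRing.isLinear.Build F (group_alg F n) (group_alg F n) *:%R (ga_mul x)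
    (ga_mul_is_linear x).

(** The swapped arguments let linearity in the left factor be declared as a linear structure. *)
Definition ga_mulr y x := ga_mul x y.

Lemma ga_mulr_is_linear y : linear (ga_mulr y).
Proof.
move=> k x z; rewrite /ga_mulr /ga_mul scaler_sumr -big_split /=.
by apply: eq_bigr => s _; rewrite !ffunE scalerDl scalerA.
Qed.

HB.instance Definition _ y :=
  GRing.isLinear.Build F (group_alg F n) (group_alg F n) *:%R (ga_mulr y)
    (ga_mulr_is_linear y).

Lemma ga_mulZl k x y : ga_mul (k *: x) y = k *: ga_mul x y.
Proof. exact: (linearZ_LR (ga_mulr y)). Qed.

Lemma ga_mul_suml (I : Type) (r : seq I) (P : pred I) (f : I -> group_alg F n) y :
  ga_mul (\sum_(i <- r | P i) f i) y = \sum_(i <- r | P i) ga_mul (f i) y.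
Proof. exact: (linear_sum (ga_mulr y)). Qed.

Lemma ga_mul_left_mul s x y : ga_mul (left_mul s x) y = left_mul s (ga_mul x y).
Proof.
rewrite /ga_mul linear_sum /= (reindex_inj (mulgI s)) /=.
by apply: eq_bigr => t _; rewrite ffunE mulKg linearZ /= left_mulM.
Qed.

Lemma ga_mulA x y z : ga_mul x (ga_mul y z) = ga_mul (ga_mul x y) z.
Proof.
rewrite [ga_mul x y]/ga_mul ga_mul_suml; apply: eq_bigr => s _.
by rewrite ga_mulZl ga_mul_left_mul.
Qed.

End GroupAlgebra.

(** * Cells of the diagram *)

Section Cells.

Variables (n : nat) (eta : seq nat).
Hypothesis sum_eta : sumn eta = n.

Local Notation row := (reshape_index eta).
Local Notation col := (reshape_offset eta).

Lemma cell_inj (i j : 'I_n) : row i = row j -> col i = col j -> i = j.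
Proof.
move=> rij cij; apply: ord_inj.
by rewrite -(reshape_indexK eta i) rij cij reshape_indexK.
Qed.

Lemma row_lt (i : 'I_n) : (row i < size eta)%N.
Proof. by apply: reshape_indexP; rewrite sum_eta. Qed.

Lemma col_lt (i : 'I_n) : (col i < nth 0%N eta (row i))%N.
Proof. by apply: reshape_offsetP; rewrite sum_eta. Qed.

Lemma cell_exists (r c : nat) : (c < nth 0%N eta r)%N ->
  exists2 i : 'I_n, row i = r & col i = c.
Proof.
move=> cr; have lt_n : (flatten_index eta r c < n)%N.
  by rewrite -sum_eta flatten_indexP.
by exists (Ordinal lt_n); [exact: flatten_indexKl|exact: flatten_indexKr].
Qed.

(* Counting the cells that [t] sends to the first [m] columns row by row, where
   [m] is the length of row [r]: no row can contain more of them than it has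
   cells in those columns, and the totals agree. *)
Lemma col_image_lt (t : 'S_n) :
  (forall x y : 'I_n, row x = row y -> col (t x) = col (t y) -> x = y) ->
  forall x : 'I_n, (col (t x) < nth 0%N eta (row x))%N.
Proof.
move=> tP x0; set m := nth 0%N eta (row x0).
pose A (r : 'I_(size eta)) := [set x : 'I_n | (row x == r) && (col (t x) < m)%N].
pose B (r : 'I_(size eta)) := [set x : 'I_n | (row x == r) && (col x < m)%N].
have AB r : (#|A r| <= #|B r|)%N.
  have [rm|/ltnW mr] := leqP (nth 0%N eta r) m.
    apply/subset_leq_card/fintype.subsetP => x; rewrite !inE => /andP[/eqP xr _].
    by rewrite xr eqxx (leq_trans (col_lt x)) ?xr.
  apply: (@leq_trans m).
    rewrite cardE -(size_map (fun x => col (t x))) -[leqRHS](size_iota 0 m) uniq_leq_size //.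
      rewrite map_inj_in_uniq ?enum_uniq // => x y.
      rewrite !mem_enum !inE => /andP[/eqP xr _] /andP[/eqP yr _].
      by apply: tP; rewrite xr yr.
    by move=> c /mapP[x]; rewrite mem_enum inE => /andP[_ xm] ->; rewrite mem_iota.
  rewrite cardE -(size_map (fun x : 'I_n => col x)) -[leqLHS](size_iota 0 m) uniq_leq_size ?iota_uniq //.
  move=> c; rewrite mem_iota /= add0n => cm.
  have [x xr xc] := cell_exists (leq_trans cm mr).
  by apply/mapP; exists x; rewrite ?mem_enum ?inE ?xr ?xc ?eqxx.
have count_rows (P : pred 'I_n) :
    \sum_(r < size eta) #|[set x : 'I_n | (row x == r) && P x]| = #|[set x | P x]|.
  rewrite -sum1_card (partition_big (fun x => Ordinal (row_lt x)) xpredT) //=.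
  apply: eq_bigr => r _; rewrite -sum1_card; apply: eq_bigl => x.
  by rewrite !inE andbC; congr (_ && _); apply/eqP/eqP => [->|/(congr1 val)].
have sumAB : \sum_r #|A r| = \sum_r #|B r|.
  rewrite !count_rows -(card_imset _ (@perm_inj _ t)); apply: eq_card => x.
  rewrite !inE; apply/imsetP/idP => [[y yP ->]|xm]; last first.
    by exists (t^-1 x)%g; rewrite ?inE permKV.
  by move: yP; rewrite inE.
have [_] := leqif_sum (fun r (_ : true) => leqif_eq (AB r)).
rewrite sumAB eqxx => /esym/forallP/(_ (Ordinal (row_lt x0)))/= /eqP cardAB.
suff : x0 \in A (Ordinal (row_lt x0)) by rewrite inE => /andP[].
suff /eqP -> : A (Ordinal (row_lt x0)) == [set x : 'I_n | row x == row x0].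
  by rewrite inE eqxx.
rewrite eqEcard cardAB; apply/andP; split.
  by apply/fintype.subsetP => x; rewrite !inE => /andP[].
apply/subset_leq_card/fintype.subsetP => x; rewrite !inE => /eqP xr.
by rewrite xr eqxx -[m]/(nth _ _ _) -xr col_lt.
Qed.

(** Let [p] move [x] to the cell in the row of [x] and the column of [t x]. That cell exists by
    [col_image_lt], and the hypothesis on [t] makes [p] injective. *)
Lemma row_col_decomposition (t : 'S_n) :
  (forall x y : 'I_n, row x = row y -> col (t x) = col (t y) -> x = y) ->
  exists p q, [/\ p \in row_stab n eta, q \in col_stab n eta & t = (p * q)%g].
Proof.
move=> tP.
have /fin_all_exists2[g gr gc] x := cell_exists (col_image_lt tP x).
have g_inj : injective g.
  by move=> x y gxy; apply: tP; [rewrite -gr gxy gr | rewrite -gc gxy gc].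
pose p := perm g_inj; have pE x : p x = g x by exact: permE.
exists p, (p^-1 * t)%g; split; last by rewrite mulKVg.
  by rewrite inE; apply/forallP => x; rewrite pE; apply/eqP/gr.
rewrite inE; apply/forallP => x; apply/eqP; rewrite permM.
transitivity (col (g (p^-1 x)%g)); first by rewrite gc.
by rewrite -pE permKV.
Qed.

Lemma row_tperm (x y : 'I_n) : row x = row y -> tperm x y \in row_stab n eta.
Proof.
by move=> xy; rewrite inE; apply/forallP => i; case: tpermP => [->|->|_ _]; apply/eqP.
Qed.

Lemma col_tperm (x y : 'I_n) : col x = col y -> tperm x y \in col_stab n eta.
Proof.
by move=> xy; rewrite inE; apply/forallP => i; case: tpermP => [->|->|_ _]; apply/eqP.
Qed.

End Cells.

Lemma row_stab_group_set (n : nat) (eta : seq nat) : group_set (row_stab n eta).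
Proof.
apply/group_setP; split=> [|s t]; rewrite !inE.
  by apply/forallP => i; rewrite perm1.
by move=> /forallP sP /forallP tP; apply/forallP => i; rewrite permM (eqP (tP _)).
Qed.
Canonical row_stab_group n eta := Group (row_stab_group_set n eta).

Lemma col_stab_group_set (n : nat) (eta : seq nat) : group_set (col_stab n eta).
Proof.
apply/group_setP; split=> [|s t]; rewrite !inE.
  by apply/forallP => i; rewrite perm1.
by move=> /forallP sP /forallP tP; apply/forallP => i; rewrite permM (eqP (tP _)).
Qed.
Canonical col_stab_group n eta := Group (col_stab_group_set n eta).

(** * The Young symmetrizer *)

Section Star.

Variables (C : numClosedFieldType) (n : nat).
Implicit Types x y z : group_alg C n.

(** The conjugate-linear involution that inverts group elements. *)
Definition ga_star x : group_alg C n := [ffun s => (x s^-1%g)^*].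

Lemma ga_starK : involutive ga_star.
Proof. by move=> x; apply/ffunP => s; rewrite !ffunE invgK conjCK. Qed.

Lemma ga_star_mul x y : ga_star (ga_mul x y) = ga_mul (ga_star y) (ga_star x).
Proof.
apply/ffunP => t; rewrite ffunE !ga_mulE rmorph_sum /= (reindex_inj (mulgI t^-1%g)).
by apply: eq_bigr => s _; rewrite !ffunE rmorphM mulrC !invMg !invgK mulgK.
Qed.

(** The coefficient of [x^* x] at the identity is the sum of the squared moduli of the coefficients
    of [x]. *)
Lemma ga_star_mul_eq0 x : ga_mul (ga_star x) x = 0 -> x = 0.
Proof.
move/ffunP/(_ 1%g); rewrite ga_mulE ffunE => /eqP.
under eq_bigr do rewrite ffunE mulg1 mulrC -normCK.
rewrite psumr_eq0 => [/allP x0|s _]; last exact: exprn_ge0.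
apply/ffunP => s; rewrite ffunE; apply/eqP.
have := x0 s^-1%g (mem_index_enum _); rewrite invgK.
by rewrite expf_eq0 normr_eq0.
Qed.

End Star.

Section YoungSymmetrizer.

Variables (C : numClosedFieldType) (n : nat) (eta : seq nat).
Hypothesis sum_eta : sumn eta = n.
Implicit Types x y z : group_alg C n.

Let R := row_stab n eta.
Let K := col_stab n eta.

Definition row_sym : group_alg C n := [ffun s => (s \in R)%:R].
Definition col_alt : group_alg C n := [ffun s => (s \in K)%:R * (-1) ^+ s].

Lemma row_sym_mul x : ga_mul row_sym x = \sum_(p in R) left_mul p x.
Proof.
rewrite /ga_mul [RHS]big_mkcond; apply: eq_bigr => s _; rewrite ffunE.
by case: (s \in R); rewrite ?scale1r ?scale0r.
Qed.

Lemma col_alt_mul x :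
  ga_mul col_alt x = \sum_(q in K) (-1) ^+ q *: left_mul q x.
Proof.
rewrite /ga_mul [RHS]big_mkcond; apply: eq_bigr => s _; rewrite ffunE.
by case: (s \in K); rewrite ?mul1r ?mul0r ?scale0r.
Qed.

Lemma young_symmetrizerE : young_symmetrizer C n eta = ga_mul row_sym col_alt.
Proof.
apply/ffunP => t; rewrite row_sym_mul ffunE sum_ffunE; apply: eq_bigr => p _.
rewrite !ffunE; case: (boolP (_ \in K)) => [|/negP] pt.
  rewrite mul1r; apply: big_pred1 => q.
  by apply/andP/eqP => [[_ /eqP <-]|->]; rewrite ?mulKg ?mulKVg.
rewrite mul0r; apply: big_pred0 => q; apply/negP => /andP[qK /eqP pqt].
by apply: pt; rewrite -pqt mulKg.
Qed.

Lemma ga_star_row_sym : ga_star row_sym = row_sym.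
Proof. by apply/ffunP => s; rewrite !ffunE groupV rmorph_nat. Qed.

Lemma ga_star_col_alt : ga_star col_alt = col_alt.
Proof.
by apply/ffunP => s; rewrite !ffunE groupV rmorphM rmorph_nat odd_permV rmorph_sign.
Qed.

Lemma row_sym_left_mul p x : p \in R -> ga_mul row_sym (left_mul p x) = ga_mul row_sym x.
Proof.
move=> pR; rewrite !row_sym_mul [RHS](reindex_inj (mulIg p)) /=.
by apply: eq_big => [s|s _]; rewrite ?groupMr // left_mulM.
Qed.

Lemma left_mul_col_alt q : q \in K -> left_mul q col_alt = (-1) ^+ q *: col_alt.
Proof.
move=> qK; apply/ffunP => s; rewrite !ffunE groupMl ?groupV //.
by rewrite odd_permM odd_permV signr_addb mulrCA.
Qed.

Lemma row_sym_fixed x : {in R, forall p, left_mul p x = x} ->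
  ga_mul row_sym x = #|R|%:R *: x.
Proof.
by move=> xR; rewrite row_sym_mul (eq_bigr _ xR) sumr_const scaler_nat.
Qed.

Lemma col_alt_sq : ga_mul col_alt col_alt = #|K|%:R *: col_alt.
Proof.
rewrite col_alt_mul scaler_nat -sumr_const; apply: eq_bigr => q qK.
by rewrite left_mul_col_alt // scalerA -expr2 sqrr_sign scale1r.
Qed.

(* Von Neumann's lemma: if [t] is not the product of a row and a column
   permutation, then [t] sends two cells of some row to the same column, and
   their transposition makes the [t]-term equal to its opposite. *)
Lemma row_sym_col_alt_sandwich x : exists k,
  ga_mul row_sym (ga_mul x col_alt) = k *: young_symmetrizer C n eta.
Proof.
have /fin_all_exists[k kP] (t : 'S_n) : exists k,
    ga_mul row_sym (left_mul t col_alt) = k *: young_symmetrizer C n eta.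
  pose bad (u : 'I_n * 'I_n) := [&& u.1 != u.2,
    reshape_index eta u.1 == reshape_index eta u.2 &
    reshape_offset eta (t u.1) == reshape_offset eta (t u.2)].
  have [[x1 x2]|tP] := pickP bad.
    rewrite /bad /= => /and3P[x12 /eqP r12 /eqP c12].
    exists 0; rewrite scale0r; set v := ga_mul _ _.
    have vN : v = - v.
      (* Conjugating by [t] turns the transposition of [x1], [x2] into that of their images, an odd
         column permutation. *)
      rewrite {1}/v -(row_sym_left_mul _ (row_tperm r12)) left_mulM conjgC tpermJ.
      rewrite -left_mulM left_mul_col_alt ?col_tperm // odd_tperm.
      by rewrite (inj_eq perm_inj) x12 expr1 scaleN1r !linearN.
    have /eqP : 2%:R *: v = 0 by rewrite scaler_nat mulr2n {1}vN addNr.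
    by rewrite scaler_eq0 pnatr_eq0 => /eqP.
  have [|p [q [pR qK ->]]] := row_col_decomposition sum_eta (t := t).
    move=> x1 x2 r12 c12; apply/eqP; apply: contraFT (tP (x1, x2)) => x12.
    by rewrite /bad x12 r12 c12 !eqxx.
  exists ((-1) ^+ q); rewrite -left_mulM left_mul_col_alt // linearZ /=.
  by rewrite linearZ /= row_sym_left_mul // young_symmetrizerE.
exists (\sum_t x t * k t); rewrite [ga_mul x _]/ga_mul scaler_suml linear_sum.
by apply: eq_bigr => t _; rewrite linearZ /= kP scalerA.
Qed.

(* For [x] in the Specht module, [x z z^* b] is a multiple of [x] by von
   Neumann's lemma; positivity of the involution makes the factor nonzero. *)
Lemma young_mul_fixed z : {in R, forall p, left_mul p z = z} ->
  ga_mul col_alt z != 0 ->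
  ga_mul (young_symmetrizer C n eta) z != 0 /\
  {in specht C n eta, forall x, ga_mul x z = 0 -> x = 0}.
Proof.
move=> zR bz0; set a := row_sym; set b := col_alt; set c := young_symmetrizer C n eta.
have R0 : #|R|%:R != 0 :> C by rewrite pnatr_eq0 -lt0n cardG_gt0.
have az : ga_mul a z = #|R|%:R *: z by apply: row_sym_fixed.
have za : ga_mul (ga_star z) a = #|R|%:R *: ga_star z.
  rewrite -{1}[a]ga_star_row_sym -ga_star_mul az.
  by apply/ffunP => s; rewrite !ffunE rmorphM /= rmorph_nat.
pose y := ga_mul (ga_star z) (ga_mul b z).
(* As [b] is self-adjoint with [b b = #|K| b], the element [y = z^* b z] is, up to the factor
   [#|K|], of the positive form [v^* v] with [v = b z]. *)
have yE : ga_mul (ga_star (ga_mul b z)) (ga_mul b z) = #|K|%:R *: y.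
  rewrite ga_star_mul ga_star_col_alt -ga_mulA [ga_mul col_alt _]ga_mulA.
  by rewrite col_alt_sq ga_mulZl linearZ.
have y0 : y != 0.
  apply: contra_neq bz0 => yz; apply: ga_star_mul_eq0.
  by rewrite yE yz scaler0.
have ys : ga_star y = y.
  by rewrite /y !ga_star_mul ga_star_col_alt ga_starK ga_mulA.
have y20 : ga_mul y y != 0.
  by apply: contra_neq y0 => yy; apply: ga_star_mul_eq0; rewrite ys.
have zcz : ga_mul (ga_star z) (ga_mul c z) = #|R|%:R *: y.
  by rewrite /c young_symmetrizerE -ga_mulA ga_mulA za ga_mulZl.
have cz0 : ga_mul c z != 0.
  apply: contra_neq y0 => cz; move: zcz; rewrite cz linear0 => /esym/eqP.
  by rewrite scaler_eq0 (negPf R0) => /eqP.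
split=> // x xS xz.
(* With [c = a b], the sandwich [a x b] for [x = b z z^*] reads [c z z^* b = k c]. *)
have [k kE] := row_sym_col_alt_sandwich (ga_mul b (ga_mul z (ga_star z))).
have ckE : ga_mul c (ga_mul z (ga_mul (ga_star z) b)) = k *: c.
  by rewrite -kE /c young_symmetrizerE -!ga_mulA.
have xk : ga_mul x (ga_mul z (ga_mul (ga_star z) b)) = k *: x.
  (* The Specht module consists of left multiples of [c], so the relation for [c] passes to [x]. *)
  have [m ->] : exists m, x = ga_mul m c.
    have : x \in limg (linfun (ga_mulr c)).
      suff /subvP sub_limg : (specht C n eta <= limg (linfun (ga_mulr c)))%VS.
        exact: sub_limg.
      rewrite /specht; apply/span_subvP => v /fintype.imageP[s _ ->].
      apply/memv_imgP; exists [ffun t => (t == s)%:R]; rewrite ?memvf // lfunE /=.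
      rewrite /ga_mulr /ga_mul (bigD1 s) //= ffunE eqxx scale1r big1 ?addr0 //.
      by move=> t /negPf ts; rewrite ffunE ts scale0r.
    by move=> /memv_imgP[m _ ->]; exists m; rewrite lfunE.
  by rewrite -ga_mulA ckE linearZ.
(* If [k] were 0, then [z^* c z z^* b z], which equals [#|R| y y], would vanish. *)
have k0 : k != 0.
  apply: contra_neq y20 => k0; rewrite k0 scale0r in ckE.
  have : ga_mul (ga_mul (ga_star z) (ga_mul c (ga_mul z (ga_mul (ga_star z) b)))) z = 0.
    by rewrite ckE linear0 -/(ga_mulr _ _) linear0.
  rewrite [ga_mul c _]ga_mulA [ga_mul (ga_star z) (ga_mul (ga_mul _ _) _)]ga_mulA zcz.
  rewrite ga_mulZl -!ga_mulA -/y ga_mulZl => /eqP.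
  by rewrite scaler_eq0 (negPf R0) /= -!ga_mulA => /eqP.
apply/eqP; move: (congr1 (fun v => v) xk); rewrite ga_mulA xz -/(ga_mulr _ _) linear0.
by move/esym/eqP; rewrite scaler_eq0 (negPf k0).
Qed.
End YoungSymmetrizer.

(** * Column antisymmetrization *)

Section ColumnAntisymmetrization.

Variables (C : numClosedFieldType) (n : nat) (eta : seq nat).
Hypothesis sum_eta : sumn eta = n.

Local Notation row := (reshape_index eta).
Local Notation col := (reshape_offset eta).
Let R := row_stab n eta.
Let K := col_stab n eta.

Variable z : group_alg C n.
Hypothesis z_row : {in R, forall p, left_mul p z = z}.
(** The zero weight form of being killed by the raising operators: [y] is exchanged in turn with
    every cell of a higher row [a]. *)
Hypothesis z_raise : forall (a : nat) (y : 'I_n), (a < row y)%N ->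
  \sum_(x : 'I_n | row x == a) left_mul (tperm y x) z = - z.

(* Orders the cells by columns from right to left, and from top to bottom inside
   a column. *)
Let key (i : 'I_n) : nat := ((n - col i) * (size eta).+1 + row i)%N.

(** [Z m] is the antisymmetrizer over the column permutations that fix all cells of key below [m],
    applied to [z]. It interpolates between [b z] at [m = 0] and [z] itself for large [m]. *)
Let G (m : nat) := [set q in K | [forall i, (key i < m)%N ==> (q i == i)]].
Let Z (m : nat) : group_alg C n := \sum_(q in G m) (-1) ^+ q *: left_mul q z.

Lemma col_lt_n (i : 'I_n) : (col i < n)%N.
Proof. by apply: leq_ltn_trans (ltn_ord i); apply: leq_subr. Qed.

(** Row indices stay below the factor [(size eta).+1], and columns stay below [n], where the
    truncated subtraction is strictly decreasing. Keys therefore compare lexicographically. *)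
Lemma key_le x i : (key i <= key x)%N =
  (col x < col i)%N || (col x == col i) && (row i <= row x)%N.
Proof.
have ri : (row i < (size eta).+1)%N := ltnW (row_lt sum_eta i).
have rx : (row x < (size eta).+1)%N := ltnW (row_lt sum_eta x).
have lex (d e r s : nat) : (r < (size eta).+1)%N -> (d < e)%N ->
    (d * (size eta).+1 + r < e * (size eta).+1 + s)%N.
  move=> rS de; apply: (@leq_trans (d.+1 * (size eta).+1)).
    by rewrite mulSn addnC ltn_add2r.
  by rewrite (leq_trans _ (leq_addr _ _)) // leq_mul2r de orbT.
have sub_lt (j k : 'I_n) : (col j < col k)%N -> (n - col k < n - col j)%N.
  by move=> jk; rewrite ltn_sub2l // col_lt_n.
rewrite /key; case: ltngtP => [xi|ix|->]; rewrite ?leq_add2l //=.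
  by rewrite ltnW // lex ?sub_lt.
by rewrite leqNgt lex ?sub_lt.
Qed.

Lemma mem_colfix m (q : 'S_n) : reflect
  ((forall i : 'I_n, col (q i) = col i) /\ forall i, (key i < m)%N -> q i = i) (q \in G m).
Proof.
rewrite !inE; apply: (iffP andP) => [[/forallP qK /forallP qm]|[qK qm]]; split.
- by move=> i; apply/eqP/qK.
- by move=> i im; apply/eqP; move: (qm i); rewrite im.
- by apply/forallP => i; apply/eqP/qK.
- by apply/forallP => i; apply/implyP => im; apply/eqP/qm.
Qed.

Lemma colfix_mul m (s q : 'S_n) : s \in G m -> q \in G m -> (s * q)%g \in G m.
Proof.
move=> /mem_colfix[sK sm] /mem_colfix[qK qm]; apply/mem_colfix; split=> i => [|im].
  by rewrite permM qK sK.
by rewrite permM sm ?qm.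
Qed.

Lemma colfix_tperm m (i j : 'I_n) : col i = col j -> (m <= key i)%N -> (m <= key j)%N ->
  tperm i j \in G m.
Proof.
move=> cij mi mj; apply/mem_colfix; split=> [k|k km].
  by case: tpermP => [->|->|_ _]; rewrite ?cij.
by rewrite tpermD //; apply: contraTneq km => <-; rewrite -leqNgt.
Qed.

(** * Removing one cell from the antisymmetrizer *)

Section RemoveCell.

Variable x : 'I_n.
(** The arm contains [x] and the leg does not, so that their sizes add up to the hook length. *)
Let arm (y : 'I_n) := (row y == row x) && (col x <= col y)%N.
Let leg (w : 'I_n) := (col w == col x) && (row x < row w)%N.
Let Z' := Z (key x).+1.

Lemma colfix_arm (q : 'S_n) y : q \in G (key x).+1 -> arm y -> q y = y.
Proof.
move=> /mem_colfix[_ qm] /andP[/eqP yr yc]; apply: qm; rewrite ltnS key_le yr leqnn andbT.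
by rewrite orbC -leq_eqVlt.
Qed.

(** Such a [q] fixes [x] and every cell above it in its column, so it permutes the cells below. *)
Lemma colfix_leg (q : 'S_n) w : q \in G (key x).+1 -> leg w -> leg (q w).
Proof.
move=> /mem_colfix[qK qm] /andP[wc wr]; rewrite /leg qK wc ltnNge; apply/negP => qwr.
have qw : q w = w.
  by apply: (@perm_inj _ q); apply: qm; rewrite ltnS key_le qK (eqP wc) eqxx qwr orbT.
by move: qwr; rewrite qw leqNgt wr.
Qed.

(** Every [q] in the sum fixes both [x] and [y], so the transposition commutes past [q] and is
    absorbed by the row invariance of [z]. *)
Lemma colalt_arm_fixed y : arm y -> left_mul (tperm x y) Z' = Z'.
Proof.
move=> ya; have xa : arm x by rewrite /arm eqxx leqnn.
rewrite /Z' /Z linear_sum; apply: eq_bigr => q qG; rewrite linearZ /= left_mulM.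
rewrite conjgC tpermJ !(colfix_arm qG) // -left_mulM z_row // row_tperm //.
by case/andP: ya => /eqP.
Qed.

(** Sort the permutations by the cell [w] that they send to [x]: [w = x] gives [Z'], and each [w] in
    the leg gives the coset of [tperm x w], with sign -1. *)
Lemma colalt_remove_cell : Z (key x) =
  Z' - \sum_(w | leg w) left_mul (tperm x w) Z'.
Proof.
have key_inj i j : key i = key j -> i = j.
  move=> kij; have := leqnn (key i); rewrite {1}kij key_le.
  have := leqnn (key j); rewrite -{1}kij key_le.
  have [//|//|cij /= rij rji] := ltngtP (col i) (col j).
  by apply: (cell_inj _ cij); apply/eqP; rewrite eqn_leq rij rji.
have GS (q : 'S_n) : (q \in G (key x).+1) = (q \in G (key x)) && (q x == x).
  apply/mem_colfix/andP => [[qK qm]|[/mem_colfix[qK qm] /eqP qx]].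
    by split; [apply/mem_colfix; split=> // i ix; apply/qm/ltnW|apply/eqP/qm].
  by split=> // i; rewrite ltnS leq_eqVlt => /orP[/eqP/key_inj ->//|/qm].
pose P w := (w == x) || leg w.
rewrite /Z (partition_big (fun q : 'S_n => (q^-1)%g x) P) /=; last first.
  move=> q /mem_colfix[qK qm]; set w := (q^-1)%g x.
  have qw : q w = x by rewrite permKV.
  rewrite /P /leg -{2}qw qK eqxx /= -implyNb; apply/implyP => wx.
  rewrite ltnNge; apply: contra_neqN wx => wr.
  have : (key w <= key x)%N by rewrite key_le -(qK w) qw eqxx wr orbT.
  by rewrite leq_eqVlt => /orP[/eqP/key_inj //|/qm]; rewrite qw.
rewrite (bigD1 x) /=; last by rewrite /P eqxx.
congr (_ + _).
  apply: eq_bigl => q; rewrite GS; congr (_ && _).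
  by rewrite -(inj_eq (@perm_inj _ q)) permKV eq_sym.
rewrite -sumrN; apply: eq_big => [w|w wl].
  rewrite /P; case: eqP => [->|_]; rewrite /= ?andbT //.
  by rewrite /leg ltnn andbF.
have {wl} : leg w by move: wl => /andP[/orP[/eqP->|//]]; rewrite eqxx.
move=> /andP[/eqP wc wr].
have wx : x != w by apply: contraTneq wr => ->; rewrite ltnn.
have tG : tperm x w \in G (key x).
  by rewrite colfix_tperm // ltnW // ltnNge key_le wc ltnn eqxx -ltnNge.
rewrite /Z' /Z linear_sum -sumrN.
rewrite (reindex_inj (mulgI (tperm x w))) /=.
apply: eq_big => [q|q _]; last first.
  by rewrite linearZ /= left_mulM odd_permM odd_tperm wx signr_addb mulN1r scaleNr.
rewrite GS invMg permM tpermV -(inj_eq (@perm_inj _ (tperm x w))) tpermK tpermR.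
rewrite -(inj_eq (@perm_inj _ q)) permKV eq_sym; congr (_ && _).
apply/idP/idP => [tqG|]; last exact: colfix_mul.
by rewrite -[q](mulKg (tperm x w)) tpermV colfix_mul.
Qed.

(** Moving the transposition past [q] replaces [w] by [q w], which lies below row [row x]. The
    raising relation turns the sum over that whole row into [- z], and the cells to the left of [x]
    contribute nothing after antisymmetrization. *)
Lemma sum_colalt_arm_leg w : leg w -> \sum_(y | arm y) left_mul (tperm w y) Z' = - Z'.
Proof.
move=> wl.
transitivity (\sum_(q in G (key x).+1) (-1) ^+ q *:
    left_mul q (\sum_(y | arm y) left_mul (tperm (q w) y) z)).
  rewrite [LHS](eq_bigr (fun y => \sum_(q in G (key x).+1)
    (-1) ^+ q *: left_mul q (left_mul (tperm (q w) y) z))).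
    rewrite exchange_big; apply: eq_bigr => q _.
    by rewrite linear_sum scaler_sumr.
  move=> y ya; rewrite /Z' /Z linear_sum; apply: eq_bigr => q qG.
  by rewrite linearZ /= !left_mulM conjgC tpermJ (colfix_arm qG ya).
rewrite (eq_bigr (fun q : 'S_n => - ((-1) ^+ q *: left_mul q z) -
    \sum_(p : 'I_n | (row p == row x) && (col p < col x)%N)
      (-1) ^+ q *: left_mul q (left_mul (tperm (q w) p) z))).
  rewrite big_split /= !sumrN exchange_big /= [X in _ - X]big1 ?subr0 // => p.
  move=> /andP[/eqP pr pc].
  rewrite (partition_big (fun q : 'S_n => q w) leg) /=; last by move=> q qG; apply: colfix_leg.
  apply: big1 => v /andP[/eqP vc vr].
  (* The column of [p] meets the row of [v] since it lies to the left of [v]. Multiplying [q] by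
     [tperm p r] on the right flips the sign and preserves the term, because
     [(p r)(v p) = (v p)(v r)] and [(v r)] fixes [z]. *)
  have [r rr rc] : exists2 r : 'I_n, row r = row v & col r = col p.
    apply: cell_exists => //; apply: ltn_trans pc _.
    by rewrite -vc col_lt.
  set S := \sum_(q | _) _.
  have SN : S = - S.
    have pr_neq : p != r.
      by apply: contraTneq vr => p_r; rewrite -rr -p_r pr ltnn.
    have tG : tperm p r \in G (key x).+1.
      have low (i : 'I_n) : col i = col p -> (key x < key i)%N.
        by move=> ip; rewrite ltnNge key_le ip ltnNge (ltnW pc) (gtn_eqF pc).
      by rewrite colfix_tperm ?low.
    rewrite {1}/S (reindex_inj (mulIg (tperm p r))) /= /S -sumrN.
    have tv : tperm p r v = v.
      rewrite tpermD //; first by apply: contraTneq pc => ->; rewrite vc ltnn.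
      by apply: contraTneq pc => r_v; rewrite -rc r_v vc ltnn.
    apply: eq_big => [q|q /andP[_ /eqP qv]].
      rewrite permM -{1}tv (inj_eq perm_inj); congr (_ && _).
      apply/idP/idP => [qtG|qG]; last exact: colfix_mul.
      by rewrite -[q](mulgK (tperm p r)) tpermV colfix_mul.
    rewrite odd_permM odd_tperm pr_neq addbT signrN scaleNr; congr (- (_ *: _)).
    have qw : q w = v by apply: (@perm_inj _ (tperm p r)); rewrite -permM qv tv.
    rewrite qv qw !left_mulM -mulgA [(tperm p r * _)%g]conjgC tpermJ tpermR.
    rewrite tpermD ?[v == r]eq_sym //; last first.
      by apply: contraTneq pc => r_v; rewrite -rc r_v vc ltnn.
    by rewrite mulgA -(left_mulM _ (tperm v r)) [left_mul (tperm v r) z]z_row ?row_tperm // -rr.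
  have /eqP : 2%:R *: S = 0 by rewrite scaler_nat mulr2n {1}SN addNr.
  by rewrite scaler_eq0 pnatr_eq0 => /eqP.
move=> q qG; have /andP[_ /z_raise qw] := colfix_leg qG wl.
rewrite -scaler_sumr -linear_sum -scalerN -scalerBr -linearN -linearB /=.
congr (_ *: left_mul _ _).
rewrite -qw [X in _ = X - _](bigID (fun p : 'I_n => col x <= col p)%N) /=.
rewrite -addrA [X in _ + X](_ : _ = 0) ?addr0 //; apply/eqP; rewrite subr_eq0.
by apply/eqP/eq_bigl => p; rewrite -ltnNge.
Qed.

(* The factor that appears is the hook length of the cell [x]. *)
Lemma colalt_step : Z (key x) = 0 -> Z' = 0.
Proof.
move=> Z0; have /eqP : (\sum_(y | arm y) 1 + \sum_(w | leg w) 1)%N%:R *: Z' = 0.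
  rewrite natrD scalerDl !natr_sum !scaler_suml.
  (* Translating [Z (key x)] by the transpositions of [x] with its arm and summing yields one copy
     of [Z'] for each arm cell and one for each leg cell. *)
  transitivity (\sum_(y | arm y) left_mul (tperm x y) (Z (key x))); last first.
    by apply: big1 => y _; rewrite Z0 linear0.
  transitivity (\sum_(y | arm y)
      (Z' - \sum_(w | leg w) left_mul (tperm w y) Z')).
    rewrite sumrB [X in _ = _ - X]exchange_big -sumrN; congr (_ + _).
      by apply: eq_bigr => y _; rewrite scale1r.
    by apply: eq_bigr => w wl; rewrite scale1r sum_colalt_arm_leg ?opprK.
  apply: eq_bigr => y ya; rewrite colalt_remove_cell linearB /= colalt_arm_fixed //; congr (_ - _).
  rewrite [RHS]linear_sum /=; apply: eq_bigr => w wl; rewrite left_mulM.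
  case/andP: (ya) (wl) => /eqP yr _ /andP[_ wr].
  have tw : tperm x y w = w.
    by rewrite tpermD //; apply: contraTneq wr => <-; rewrite ?yr ltnn.
  (* Here [(x y)(x w) = (y w)(x y)], and the last factor fixes [Z']. *)
  by rewrite conjgCV tpermV tpermJ tpermL tw -left_mulM colalt_arm_fixed // tpermC.
rewrite scaler_eq0 pnatr_eq0 => /orP[|/eqP //].
by rewrite (bigD1 x) // /arm eqxx leqnn.
Qed.

End RemoveCell.

Lemma col_alt_mul_neq0 : z != 0 -> ga_mul (col_alt C n eta) z != 0.
Proof.
apply: contra_neq => bz0.
have Zm m : Z m = 0.
  elim: m => [|m IHm].
    rewrite -bz0 col_alt_mul; apply: eq_bigl => q; rewrite inE.
    by rewrite (_ : [forall i, _]) ?andbT //; apply/forallP.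
  have [x /eqP xm|m_key] := pickP (fun x => key x == m).
    by rewrite -xm colalt_step // xm.
  rewrite -[RHS]IHm; apply: eq_bigl => q; rewrite !inE; congr (_ && _).
  by apply: eq_forallb => i; rewrite ltnS leq_eqVlt m_key.
(* The index exceeds every key, so only the identity remains in the sum. *)
rewrite -(Zm (\sum_i (key i).+1)%N) /Z (big_pred1 1%g) => [|q].
  by rewrite odd_perm1 scale1r left_mul1.
apply/mem_colfix/eqP => [[_ qm]|->]; last by split=> i; rewrite perm1.
by apply/permP => i; rewrite perm1 qm // (bigD1 i) //= leq_addr.
Qed.

End ColumnAntisymmetrization.

(** * Submodules of the tensor power *)

(** The values at [m] distinct points determine the coefficients of a vector-valued polynomial of
    degree below [m], by inverting the Vandermonde matrix. *)
Lemma vandermonde_mem (F : fieldType) (V : vectType F) (M : {vspace V}) (m : nat)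
    (y : 'I_m -> V) (s : 'I_m -> F) : injective s ->
  (forall j, \sum_(k < m) s j ^+ k *: y k \in M) -> forall k, y k \in M.
Proof.
move=> s_inj sM k; pose W := Vandermonde m (\row_j s j).
have Wu : W \in unitmx.
  rewrite unitmxE det_Vandermonde unitfE; apply/prodf_neq0 => i _.
  apply/prodf_neq0 => j ij; rewrite !mxE subr_eq0 (inj_eq s_inj).
  by apply: contraTneq ij => ->; rewrite ltnn.
rewrite (_ : y k = \sum_j invmx W j k *: \sum_(l < m) s j ^+ l *: y l).
  by apply: memv_suml => j _; rewrite memvZ.
under eq_bigr do rewrite scaler_sumr; rewrite exchange_big /=.
rewrite (bigD1 k) //= [X in _ + X]big1 => [|l lk].
  rewrite addr0; under eq_bigr do rewrite scalerA.
  rewrite -scaler_suml (_ : \sum_j _ = (W *m invmx W) k k).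
    by rewrite mulmxV // mxE eqxx scale1r.
  by rewrite mxE; apply: eq_bigr => j _; rewrite !mxE mulrC.
under eq_bigr do rewrite scalerA.
rewrite -scaler_suml (_ : \sum_j _ = (W *m invmx W) l k).
  by rewrite mulmxV // mxE (negPf lk) scale0r.
by rewrite mxE; apply: eq_bigr => j _; rewrite !mxE mulrC.
Qed.

Section TensorPowers.

Variables (C : numClosedFieldType) (n : nat).
Implicit Types (A B : 'M[C]_n) (t : tensor C n) (M : {vspace tensor C n}).

Lemma tpow_is_linear B : linear (tpow B).
Proof.
move=> k x y; apply/ffunP => i; rewrite !ffunE scaler_sumr -big_split /=.
by apply: eq_bigr => j _; rewrite !ffunE mulrDr scalerAr.
Qed.

HB.instance Definition _ B :=
  GRing.isLinear.Build C (tensor C n) (tensor C n) *:%R (tpow B)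
    (tpow_is_linear B).

Lemma tpow_mulmx A B t : tpow (A *m B) t = tpow A (tpow B t).
Proof.
apply/ffunP => i; rewrite !ffunE.
under [RHS]eq_bigr => j _ do rewrite ffunE mulr_sumr.
rewrite exchange_big; apply: eq_bigr => j _.
under [RHS]eq_bigr do rewrite mulrA.
rewrite -mulr_suml; congr (_ * _); rewrite /tpow_coef.
under eq_bigr do rewrite mxE.
rewrite bigA_distr_bigA; apply: eq_bigr => l _.
by rewrite -big_split.
Qed.

Lemma tpow_diag (d : 'rV[C]_n) t :
  tpow (diag_mx d) t = [ffun i : {ffun 'I_n -> 'I_n} => (\prod_k d 0 (i k)) * t i].
Proof.
apply/ffunP => i; rewrite !ffunE (bigD1 i) //= big1 => [|j ji].
  by rewrite addr0; congr (_ * _); apply: eq_bigr => k _; rewrite mxE eqxx.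
have [k jik] : exists k, j k != i k.
  by apply/existsP; rewrite -negb_forall; apply: contra ji => /eqfunP/ffunP->.
rewrite /tpow_coef (bigD1 k) //= mxE eq_sym (negPf jik) mulr0n.
by rewrite !mul0r.
Qed.

(** The exponent of the [a]-th variable in the weight of the basis tensor indexed by [i]. *)
Definition fibre_card (a : 'I_n) (i : {ffun 'I_n -> 'I_n}) : nat :=
  #|[set k | i k == a]|.

Lemma prod_fibre_card (d : 'I_n -> C) (i : {ffun 'I_n -> 'I_n}) :
  \prod_k d (i k) = \prod_a d a ^+ fibre_card a i.
Proof.
rewrite (partition_big i xpredT) //=; apply: eq_bigr => a _.
rewrite (eq_bigr (fun=> d a)) => [|k /eqP-> //].
by rewrite prodr_const; congr (_ ^+ _); apply: eq_card => k; rewrite inE.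
Qed.

(** The Cayley transform [(1 + ij) / (1 - ij)] of the natural numbers supplies distinct Vandermonde
    nodes of modulus one. *)
Lemma unit_circle_inj : exists2 s : nat -> C, injective s &
  forall j, s j * (s j)^* = 1.
Proof.
pose p (j : nat) : C := 1 + 'i * j%:R; pose q (j : nat) : C := 1 - 'i * j%:R.
have qp j : (p j)^* = q j.
  by rewrite rmorphD /= rmorphM /= rmorph1 conjCi rmorph_nat mulNr.
have pq j : (q j)^* = p j by rewrite -qp conjCK.
have qpE j : q j * p j = (j ^ 2).+1%:R.
  by rewrite /q /p -subr_sqr exprMn sqrCi mulN1r opprK expr1n -natrX nat1r.
have /all_and2[p0 q0] j : p j != 0 /\ q j != 0.
  by apply/andP; rewrite andbC -negb_or -mulf_eq0 qpE pnatr_eq0.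
exists (fun j => p j / q j) => [j k|j].
  move/eqP; rewrite eqr_div // => /eqP pqjk.
  have : 2 * 'i * (j%:R - k%:R) = 0 :> C.
    transitivity (p j * q k - p k * q j); last by rewrite pqjk subrr.
    by rewrite /p /q; ring.
  move/eqP; rewrite !mulf_eq0 pnatr_eq0 (negPf (neq0Ci C)) /= subr_eq0 eqr_nat.
  by move/eqP.
by rewrite rmorphM fmorphV /= qp pq mulrA divfK // divff.
Qed.

(** * From unitary stability to stability under all matrices *)

Section UnitaryStable.

Variable M : {vspace tensor C n}.
Hypothesis Mu : unitary_stable M.

(** A diagonal unitary with [s j] at place [a] and 1 elsewhere scales the component of exponent [k]
    by [s j ^+ k], so interpolation isolates that component. *)
Lemma unitary_stable_fibre_card a (k : nat) t : t \in M ->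
  [ffun i : {ffun 'I_n -> 'I_n} => (fibre_card a i == k)%:R * t i] \in M.
Proof.
move=> tM; have [s s_inj s1] := unit_circle_inj.
have [kn|nk] := ltnP k n.+1; last first.
  rewrite (_ : finfun _ = 0) ?mem0v //; apply/ffunP => i; rewrite !ffunE.
  rewrite (_ : _ == _ = false) ?mul0r //; apply/negbTE; rewrite neq_ltn.
  by rewrite (leq_ltn_trans (max_card _)) // card_ord.
pose y (l : 'I_n.+1) : tensor C n :=
  [ffun i : {ffun 'I_n -> 'I_n} => (fibre_card a i == l)%:R * t i].
apply: (@vandermonde_mem _ _ M _ y (fun j => s j) _ _ (Ordinal kn)).
  by move=> i j /s_inj/val_inj.
move=> j; pose d : 'rV[C]_n := \row_b (if b == a then s j else 1).
rewrite (_ : \sum_l _ = tpow (diag_mx d) t).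
  apply: Mu => //; apply/unitarymxP.
  rewrite tr_diag_mx map_diag_mx mul_diag_mx; apply/matrixP => b c; rewrite !mxE.
  case: (eqVneq b c) => [->|_]; rewrite ?mulr1n ?mulr0n ?mulr0 //.
  by case: eqP => _; [exact: s1 | rewrite mul1r; exact: conjC1].
rewrite tpow_diag; apply/ffunP => i; rewrite sum_ffunE ffunE.
have ian : (fibre_card a i < n.+1)%N by rewrite ltnS (leq_trans (max_card _)) ?card_ord.
rewrite (bigD1 (Ordinal ian)) //= big1 => [|l li]; last first.
  rewrite !ffunE (_ : _ == _ = false) ?mul0r ?scaler0 //.
  by apply: contraNF li => /eqP il; apply/eqP/val_inj.
rewrite addr0 !ffunE eqxx mul1r; congr (_ * _).
rewrite (prod_fibre_card (fun b => d 0 b)) (bigD1 a) //= big1 => [|b /negPf ba].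
  by rewrite mulr1 mxE eqxx.
by rewrite mxE ba expr1n.
Qed.

Lemma unitary_stable_fibre_cards (P : 'I_n -> nat) (l : seq 'I_n) t : t \in M ->
  [ffun i : {ffun 'I_n -> 'I_n} => (all (fun a => fibre_card a i == P a) l)%:R * t i] \in M.
Proof.
move=> tM; elim: l => [|a l IHl].
  by rewrite (_ : finfun _ = t) //; apply/ffunP => i; rewrite ffunE mul1r.
have := unitary_stable_fibre_card a (P a) IHl; congr (_ \in M).
by apply/ffunP => i; rewrite !ffunE /= mulrA -natrM mulnb.
Qed.

(** On each component of fixed exponent an arbitrary diagonal entry acts by a scalar; the entries
    are treated one at a time. *)
Lemma unitary_stable_diag (d : 'rV[C]_n) t : t \in M -> tpow (diag_mx d) t \in M.
Proof.
move=> tM; pose f l : tensor C n :=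
  [ffun i : {ffun 'I_n -> 'I_n} => (\prod_(a <- l) d 0 a ^+ fibre_card a i) * t i].
suff fM l : f l \in M.
  have := fM (index_enum 'I_n); congr (_ \in M); rewrite tpow_diag.
  by apply/ffunP => i; rewrite !ffunE (prod_fibre_card (fun a => d 0 a)).
elim: l => [|a l IHl].
  by rewrite (_ : f _ = t) //; apply/ffunP => i; rewrite ffunE big_nil mul1r.
rewrite (_ : f _ = \sum_(k < n.+1) d 0 a ^+ k *:
    ([ffun i : {ffun 'I_n -> 'I_n} => (fibre_card a i == k)%:R * f l i] : tensor C n)).
  by apply: memv_suml => k _; rewrite memvZ // unitary_stable_fibre_card.
apply/ffunP => i; rewrite sum_ffunE !ffunE big_cons -mulrA.
have ian : (fibre_card a i < n.+1)%N by rewrite ltnS (leq_trans (max_card _)) ?card_ord.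
rewrite [RHS](bigD1 (Ordinal ian)) //= [X in _ + X]big1 => [|k ki]; last first.
  rewrite !ffunE (_ : _ == _ = false) ?mul0r ?scaler0 //.
  by apply: contraNF ki => /eqP il; apply/eqP/val_inj.
by rewrite addr0 !ffunE eqxx mul1r.
Qed.

(** Singular value decomposition: [B = Y D P] with [Y], [P] unitary and [D] the diagonal of the
    square roots of the eigenvalues of [B^t* *m B]. *)
Lemma unitary_stable_unitmx B t : B \in unitmx -> t \in M -> tpow B t \in M.
Proof.
move=> Bu tM; pose H := B^t* *m B.
have /orthomx_spectralP HE : H \is normalmx.
  by apply/normalmxP; rewrite trmx_mul map_mxM trmxCK.
set P := spectralmx H in HE; set sp := spectral_diag H in HE.
have Pu : P \is unitarymx by apply: spectral_unitarymx.
pose X := B *m P^t*.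
have XP : X *m P = B by rewrite -mulmxA -invmx_unitary // mulVmx ?mulmx1 ?unitarymx_unit.
have XX : X^t* *m X = diag_mx sp.
  rewrite trmx_mul map_mxM trmxCK mulmxA -[_ *m B]mulmxA -/H HE.
  rewrite -invmx_unitary // !mulmxA mulmxV ?unitarymx_unit // mul1mx.
  by rewrite mulmxK ?unitarymx_unit.
have sp_ge0 i : 0 <= sp 0 i.
  have /matrixP/(_ i i) := XX; rewrite !mxE eqxx mulr1n => <-.
  by apply: sumr_ge0 => k _; rewrite !mxE mulrC mul_conjC_ge0.
have sp0 i : sp 0 i != 0.
  have Xu : X \in unitmx by rewrite unitmx_mul Bu -invmx_unitary // unitmx_inv unitarymx_unit.
  have : diag_mx sp \in unitmx by rewrite -XX unitmx_mul map_unitmx unitmx_tr Xu.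
  by rewrite unitmxE det_diag unitfE => /prodf_neq0/(_ i isT).
have [r r_sq rC] : exists2 r : 'rV[C]_n, forall i, sp 0 i = r 0 i ^+ 2 &
    forall i, (r 0 i)^* = r 0 i.
  exists (\row_i sqrtC (sp 0 i)) => i; rewrite mxE ?sqrtCK //.
  by apply/CrealP; rewrite ger0_real // sqrtC_ge0.
have r0 i : r 0 i != 0 by have := sp0 i; rewrite r_sq expf_eq0.
pose Y := X *m diag_mx (\row_i (r 0 i)^-1).
have Yu : Y \is unitarymx.
  rewrite -trmxC_unitary; apply/unitarymxP; rewrite trmxCK.
  rewrite trmx_mul map_mxM mulmxA -[_ *m X]mulmxA XX tr_diag_mx map_diag_mx.
  rewrite !mul_mx_diag; apply/matrixP => i j; rewrite !mxE.
  case: eqVneq => [->|_]; rewrite ?mulr1n ?mulr0n ?mul0r //.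
  by rewrite fmorphV /= r_sq rC expr2 mulrA mulVf // mul1r mulfV.
have -> : B = Y *m diag_mx r *m P.
  rewrite -XP; congr (_ *m _); rewrite -mulmxA mul_diag_mx.
  rewrite (_ : \matrix_(_, _) _ = 1%:M) ?mulmx1 //; apply/matrixP => i j; rewrite !mxE.
  by case: eqVneq => [->|_]; rewrite ?mulr1n ?mulr0n ?mulr0 // mulVf.
rewrite (tpow_mulmx _ P) (tpow_mulmx Y); apply: Mu => //; apply: unitary_stable_diag; exact: Mu.
Qed.

(** Gaussian elimination writes [B] as a 0-1 diagonal matrix between two invertible ones. *)
Lemma unitary_stable_tpow B t : t \in M -> tpow B t \in M.
Proof.
move=> tM; rewrite -(mulmx_ebase B) !tpow_mulmx.
rewrite unitary_stable_unitmx ?col_ebase_unit //.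
rewrite (_ : pid_mx _ = diag_mx (\row_k (k < \rank B)%:R)); last first.
  apply/matrixP => j k; rewrite !mxE -val_eqE /=.
  by case: eqP => [->|_]; rewrite ?mulr1n ?mulr0n.
by rewrite unitary_stable_diag // unitary_stable_unitmx ?row_ebase_unit.
Qed.

End UnitaryStable.
End TensorPowers.

(** * The zero weight space *)

(** Take a subspace of maximal dimension inside [P]: adjoining a further vector of [P] cannot
    enlarge it. *)
Lemma vspace_of_closed (F : fieldType) (V : vectType F) (P : V -> Prop) :
  P 0 -> (forall k u v, P u -> P v -> P (k *: u + v)) ->
  exists U : {vspace V}, forall v, v \in U <-> P v.
Proof.
move=> P0 PP; pose ok d := `[< exists2 U : {vspace V}, {in U, forall v, P v} & \dim U = d >].
have ok0 : exists d, ok d.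
  exists 0%N; apply/asboolP; exists 0%VS; rewrite ?dimv0 // => v.
  by rewrite memv0 => /eqP->.
have ok_le d : ok d -> (d <= \dim {:V})%N.
  by move=> /asboolP[U _ <-]; rewrite dimvS ?subvf.
case: (ex_maxnP ok0 ok_le) => d /asboolP[U UP dU] d_max.
exists U => v; split=> [|Pv]; first exact: UP.
have : ok (\dim (U + <[v]>)%VS).
  apply/asboolP; exists (U + <[v]>)%VS => // _ /memv_addP[u uU [_ /vlineP[k ->] ->]].
  by rewrite addrC; apply: PP => //; apply: UP.
move=> /d_max; rewrite -dU => dUv.
have -> : U = (U + <[v]>)%VS by apply/eqP; rewrite eqEdim addvSl.
by apply: (subvP (addvSr _ _)); rewrite memv_line.
Qed.

Section ZeroWeight.

Variables (C : numClosedFieldType) (n : nat).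
Implicit Types (x y : group_alg C n) (t : tensor C n) (s r : 'S_n).

Definition perm_ffun s : {ffun 'I_n -> 'I_n} := [ffun k => s k].

Lemma perm_ffun_inj : injective perm_ffun.
Proof. by move=> s r /ffunP sr; apply/permP => k; have := sr k; rewrite !ffunE. Qed.

Lemma perm_ffun_fibre_card s a : fibre_card a (perm_ffun s) = 1%N.
Proof.
rewrite -(cards1 (s^-1 a)%g); apply: eq_card => k; rewrite !inE ffunE.
by rewrite -(inj_eq (@perm_inj _ s) k) permKV.
Qed.

Lemma fibre_card_perm_ffun (i : {ffun 'I_n -> 'I_n}) :
  (forall a, fibre_card a i = 1%N) -> exists s, i = perm_ffun s.
Proof.
move=> i1; have i_inj : injective i.
  move=> k l ikl; have /eqP/cards1P[m mP] := i1 (i k).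
  have : k \in [set m] by rewrite -mP inE.
  have : l \in [set m] by rewrite -mP inE ikl.
  by rewrite !inE => /eqP-> /eqP->.
by exists (perm i_inj); apply/ffunP => k; rewrite ffunE permE.
Qed.

(** A group element corresponds to the tensor of its inverse, which makes permutation matrices act
    by left translation. *)
Definition ga_tensor x : tensor C n :=
  \sum_s x s^-1%g *: pure_tensor (fun k => basis_vec C (s k)).

(** Defined on all tensors: it discards the components outside the zero weight space. *)
Definition tensor_ga t : group_alg C n := [ffun s => t (perm_ffun s^-1%g)].

Lemma pure_tensor_perm s i :
  pure_tensor (fun k => basis_vec C (s k)) i = (i == perm_ffun s)%:R.
Proof.
rewrite ffunE; case: eqP => [->|/eqP is_]; first by rewrite big1 // => k _; rewrite mxE ffunE !eqxx.
have [k ik] : exists k, i k != s k.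
  apply/existsP; rewrite -negb_forall; apply: contra is_ => /forallP is_.
  by apply/eqP/ffunP => k; rewrite ffunE; apply/eqP.
by rewrite (bigD1 k) //= mxE (negPf ik) mul0r.
Qed.

Lemma ga_tensor_perm x s : ga_tensor x (perm_ffun s) = x s^-1%g.
Proof.
rewrite sum_ffunE (bigD1 s) //= big1 => [|r rs].
  by rewrite ffunE pure_tensor_perm eqxx addr0 [_ *: _]mulr1.
by rewrite ffunE pure_tensor_perm (inj_eq perm_ffun_inj) eq_sym (negPf rs) scaler0.
Qed.

Lemma ga_tensor_eq0 x i : (forall s, i <> perm_ffun s) -> ga_tensor x i = 0.
Proof.
move=> is_; rewrite sum_ffunE big1 // => s _.
by rewrite ffunE pure_tensor_perm; case: eqP => [/is_ //|_]; rewrite scaler0.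
Qed.

Lemma ga_tensorK : cancel ga_tensor tensor_ga.
Proof. by move=> x; apply/ffunP => s; rewrite ffunE ga_tensor_perm invgK. Qed.

Lemma tensor_gaK t : (forall i, (forall s, i <> perm_ffun s) -> t i = 0) ->
  ga_tensor (tensor_ga t) = t.
Proof.
move=> t0; apply/ffunP => i.
have [[s ->]|is_] := pselect (exists s, i = perm_ffun s).
  by rewrite ga_tensor_perm ffunE invgK.
have is' s : i <> perm_ffun s by move=> i_s; apply: is_; exists s.
by rewrite t0 // ga_tensor_eq0.
Qed.

Lemma ga_tensor_is_linear : linear ga_tensor.
Proof.
move=> k x y; rewrite /ga_tensor scaler_sumr -big_split /=.
by apply: eq_bigr => s _; rewrite !ffunE scalerDl scalerA.
Qed.

HB.instance Definition _ :=
  GRing.isLinear.Build C (group_alg C n) (tensor C n) *:%R ga_tensor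
    ga_tensor_is_linear.

Lemma tensor_ga_is_linear : linear tensor_ga.
Proof. by move=> k x y; apply/ffunP => s; rewrite !ffunE. Qed.

HB.instance Definition _ :=
  GRing.isLinear.Build C (tensor C n) (group_alg C n) *:%R tensor_ga
    tensor_ga_is_linear.

Lemma limg_ga_tensor : limg (linfun ga_tensor) = zero_weight C n.
Proof.
apply/eqP; rewrite eqEsubv; apply/andP; split.
  apply/subvP => _ /memv_imgP[x _ ->]; rewrite lfunE /= /ga_tensor.
  by apply: memv_suml => s _; rewrite memvZ // memv_span //; apply/fintype.imageP; exists s.
rewrite /zero_weight; apply/span_subvP => _ /fintype.imageP[s _ ->].
apply/memv_imgP; exists [ffun r => (r == s^-1%g)%:R]; rewrite ?memvf // lfunE /=.
rewrite /ga_tensor (bigD1 s) //= ffunE eqxx scale1r big1 ?addr0 // => r rs.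
by rewrite ffunE (inj_eq invg_inj) (negPf rs) scale0r.
Qed.

Lemma tpow_perm_mx r t i : tpow (perm_mx r) t i = t [ffun k => r (i k)].
Proof.
rewrite ffunE (bigD1 [ffun k => r (i k)]) //= big1 => [|j ji].
  by rewrite /tpow_coef big1 ?mul1r ?addr0 // => k _; rewrite !mxE ffunE eqxx.
have [k jik] : exists k, j k != r (i k).
  apply/existsP; rewrite -negb_forall; apply: contra ji => /forallP ji.
  by apply/eqP/ffunP => k; rewrite ffunE; apply/eqP.
by rewrite /tpow_coef (bigD1 k) //= !mxE eq_sym (negPf jik) !mul0r.
Qed.

(** The general kernel [c] covers both a tensor power and its Haar average. *)
Lemma tensor_ga_kernel (c : {ffun 'I_n -> 'I_n} -> {ffun 'I_n -> 'I_n} -> C)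
    (E : 'S_n -> C) x :
  (forall s r, c (perm_ffun s) (perm_ffun (s * r)%g) = E r) ->
  tensor_ga [ffun i => \sum_j c i j * ga_tensor x j] =
    \sum_(r : 'S_n) E r *: left_mul r x.
Proof.
move=> cE; apply/ffunP => s; rewrite sum_ffunE !ffunE.
rewrite (bigID (mem (codom perm_ffun))) /= [X in _ + X]big1 ?addr0; last first.
  move=> j jP; rewrite ga_tensor_eq0 ?mulr0 // => r jr.
  by move: jP; rewrite jr codom_f.
have codom_uniq : uniq (codom perm_ffun).
  by rewrite map_inj_uniq ?enum_uniq //; apply: perm_ffun_inj.
rewrite -(big_uniq _ codom_uniq) big_image (reindex_inj (mulgI s^-1%g)) /=.
apply: eq_bigr => r _.
by rewrite ga_tensor_perm cE !ffunE invMg invgK.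
Qed.

Lemma tpow_coef_perm (B : 'M[C]_n) s r :
  tpow_coef B (perm_ffun s) (perm_ffun (s * r)%g) = \prod_k B k (r k).
Proof.
rewrite /tpow_coef [RHS](reindex_inj (@perm_inj _ s)) /=.
by apply: eq_bigr => k _; rewrite !ffunE permM.
Qed.

Lemma tensor_ga_tpow B x :
  tensor_ga (tpow B (ga_tensor x)) = \sum_(r : 'S_n) (\prod_k B k (r k)) *: left_mul r x.
Proof. exact/tensor_ga_kernel/tpow_coef_perm. Qed.

Lemma tpow_perm_ga_tensor r x :
  tpow (perm_mx r) (ga_tensor x) = ga_tensor (left_mul r x).
Proof.
apply/ffunP => i; rewrite tpow_perm_mx.
have [[s ->]|is_] := pselect (exists s, i = perm_ffun s).
  rewrite (_ : finfun _ = perm_ffun (s * r)%g); last first.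
    by apply/ffunP => k; rewrite !ffunE permM.
  by rewrite !ga_tensor_perm ffunE invMg.
rewrite !ga_tensor_eq0 // => s i_s; apply: is_; first by exists s.
exists (s * r^-1)%g; apply/ffunP => k; have /ffunP/(_ k) := i_s.
by rewrite !ffunE permM => <-; rewrite permK.
Qed.

Lemma perm_mx_unitary r : perm_mx r \is @unitarymx C n n.
Proof. by apply/unitarymxP; rewrite tr_perm_mx map_perm_mx -perm_mxM mulgV perm_mx1. Qed.

End ZeroWeight.

(** * Highest weight vectors *)

Lemma size_le_sumn (eta : seq nat) : 0%N \notin eta -> (size eta <= sumn eta)%N.
Proof.
elim: eta => //= a eta IH; rewrite inE negb_or eq_sym -lt0n => /andP[a0 /IH].
by move=> le_sum; rewrite -add1n leq_add.
Qed.

Lemma fibre_card_comp_perm (n : nat) (s : 'S_n) (i : {ffun 'I_n -> 'I_n}) a :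
  fibre_card a [ffun k => i (s k)] = fibre_card a i.
Proof.
rewrite /fibre_card -(card_imset _ (@perm_inj _ s)); apply: eq_card => k.
rewrite inE; apply/imsetP/idP => [[l]|ik]; first by rewrite inE ffunE => ? ->.
by exists (s^-1 k)%g; rewrite ?inE ?ffunE permKV.
Qed.

Lemma eq_fibre_card_perm (n : nat) (i j : {ffun 'I_n -> 'I_n}) :
  (forall a, fibre_card a i = fibre_card a j) ->
  exists s : 'S_n, i = [ffun k => j (s k)].
Proof.
move=> ij; have : perm_eq [tuple i k | k < n] [tuple j k | k < n].
  apply/allP => a _ /=; apply/eqP.
  have count_fibre (f : {ffun 'I_n -> 'I_n}) :
      count_mem a [tuple f k | k < n] = fibre_card a f.
    rewrite count_map -sum1_count big_enum_cond /= /fibre_card -sum1_card.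
    by apply: eq_bigl => k; rewrite !inE.
  by rewrite !count_fibre.
move=> /tuple_permP[s sP]; exists s; apply/ffunP => k; rewrite ffunE.
move/val_inj/(congr1 (fun t => tnth t k)): sP.
by rewrite !tnth_mktuple.
Qed.

Section HighestWeight.

Variables (C : numClosedFieldType) (n : nat) (eta : seq nat).
Hypothesis eta_part : is_partition n eta.

Let sum_eta : sumn eta = n.
Proof. by case/and3P: eta_part => _ _ /eqP. Qed.

Lemma row_lt_n (k : 'I_n) : (reshape_index eta k < n)%N.
Proof.
apply: leq_trans (row_lt sum_eta k) _.
by rewrite -sum_eta size_le_sumn //; case/and3P: eta_part.
Qed.

Definition row_ffun : {ffun 'I_n -> 'I_n} := [ffun k => Ordinal (row_lt_n k)].

Lemma row_ffun_fibre_card a : fibre_card a row_ffun = nth 0%N eta a.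
Proof.
have /fin_all_exists2[f fr fc] (c : 'I_(nth 0%N eta a)) :=
  cell_exists sum_eta (ltn_ord c).
have f_inj : injective f by move=> c d cd; apply: val_inj; rewrite /= -fc cd fc.
rewrite -[RHS]card_ord -(card_imset _ f_inj); apply: eq_card => k; rewrite inE.
rewrite ffunE -val_eqE /=; apply/eqP/imsetP => [ka|[c _ ->]]; last exact: fr.
have ck : (reshape_offset eta k < nth 0%N eta a)%N by rewrite -ka col_lt.
exists (Ordinal ck) => //; apply: (cell_inj (eta := eta)); first by rewrite fr.
by rewrite fc.
Qed.

Variable w : tensor C n.
Hypothesis w_hw : forall g : 'M[C]_n, g \in unitmx ->
  (forall i j : 'I_n, (j < i)%N -> g i j = 0) ->
  tpow g w = (\prod_(i < n) g i i ^+ nth 0%N eta i) *: w.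

(** The diagonal matrix with 2 at place [a] and 1 elsewhere scales the coefficient at [j] by 2 to
    the power [fibre_card a j], and scales [w] by 2 to the [a]-th part of [eta]. *)
Lemma hw_support j a : w j != 0 -> fibre_card a j = nth 0%N eta a.
Proof.
move=> wj; pose d : 'rV[C]_n := \row_b (if b == a then 2 else 1).
have d0 b : d 0 b != 0 by rewrite mxE; case: ifP; rewrite ?oner_eq0 ?pnatr_eq0.
have := w_hw (g := diag_mx d); rewrite unitmxE det_diag unitfE.
have -> : \prod_i d 0 i != 0 by apply/prodf_neq0 => b _.
have d_up (i k : 'I_n) : (k < i)%N -> diag_mx d i k = 0.
  by move=> ki; rewrite mxE -val_eqE (gtn_eqF ki).
move=> /(_ isT d_up)/ffunP/(_ j); rewrite tpow_diag !ffunE => /(mulIf wj).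
rewrite (prod_fibre_card (fun b => d 0 b)).
have prodE (m : 'I_n -> nat) : \prod_b d 0 b ^+ m b = 2 ^+ m a.
  rewrite (bigD1 a) //= big1 ?mulr1 => [|b /negPf ba]; first by rewrite mxE eqxx.
  by rewrite mxE ba expr1n.
rewrite prodE; under eq_bigr do rewrite mxE eqxx mulr1n.
rewrite prodE -!natrX => /eqP; rewrite eqr_nat eqn_exp2l // => /eqP.
exact.
Qed.

(** The unipotent matrix [1 + delta_mx a c] fixes [w]; compare coefficients at [i]. Since [w] lives
    in weight [eta] and [i] has one [c] too few, [w i] vanishes and only the terms that change
    exactly one [a] into [c] survive. *)
Lemma hw_raise (i : {ffun 'I_n -> 'I_n}) (a c : 'I_n) : (a < c)%N ->
  (fibre_card c i).+1 = nth 0%N eta c ->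
  \sum_(k | i k == a) w [ffun l => if l == k then c else i l] = 0.
Proof.
move=> ac ic; pose g : 'M[C]_n := 1%:M + delta_mx a c.
have ca : c != a by rewrite -val_eqE (gtn_eqF ac).
have gE k l : g k l = ((k == l) || (k == a) && (l == c))%:R.
  rewrite !mxE; case: eqVneq => [->|_]; last by rewrite add0r.
  by case: eqVneq => [->|_]; rewrite ?addr0 // eq_sym (negPf ca) addr0.
have g_up (k l : 'I_n) : (l < k)%N -> g k l = 0.
  move=> lk; rewrite gE -val_eqE (gtn_eqF lk) /=.
  by case: eqP lk => //= ->; case: eqP => //= -> /(ltn_trans ac); rewrite ltnn.
have g_diag k : g k k = 1 by rewrite gE eqxx.
have g_unit : g \in unitmx.
  rewrite -unitmx_tr unitmxE det_trig; last by apply/is_trig_mxP => k l kl; rewrite mxE g_up.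
  by rewrite big1 ?unitr1 // => k _; rewrite mxE g_diag.
have := w_hw g_unit g_up; rewrite big1 => [|k _]; last by rewrite g_diag expr1n.
rewrite scale1r => /ffunP/(_ i); rewrite ffunE.
have -> : w i = 0.
  by apply/eqP; apply: contra_eqT ic => wi; rewrite -(hw_support c wi) eqn_leq ltnn.
pose up k : {ffun 'I_n -> 'I_n} := [ffun l => if l == k then c else i l].
have up_inj : {in [pred k | i k == a] &, injective up}.
  move=> k l; rewrite !inE => /eqP ik /eqP il /ffunP/(_ k); rewrite !ffunE eqxx.
  by case: eqP => // _ ci; move: ca; rewrite ci ik eqxx.
have upE j : tpow_coef g i j * w j != 0 -> exists2 k, i k == a & j = up k.
  rewrite mulf_eq0 negb_or => /andP[/prodf_neq0 gij /(hw_support c) jc].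
  have ijP k : i k = j k \/ i k = a /\ j k = c.
    have := gij k isT; rewrite gE pnatr_eq0 eqb0 negbK.
    by case/orP => [/eqP->|/andP[/eqP-> /eqP->]]; [left|right].
  pose S := [set k | i k != j k].
  have SP k : k \in S -> i k = a /\ j k = c.
    by rewrite inE; case: (ijP k) => [->|//]; rewrite eqxx.
  (* The number of changed places is the difference between the counts of [c] in [j] and in [i]. *)
  have /eqP/cards1P[k0 k0P] : #|S| = 1%N.
    apply: (@addIn (fibre_card c i)); rewrite add1n ic -jc.
    rewrite {2}/fibre_card -[RHS](cardsID S); congr (_ + _)%N.
      by apply: eq_card => k; rewrite finset.in_setI andb_idl // inE => /SP[_ ->].
    apply: eq_card => k; rewrite !inE negbK.
    by case: (ijP k) => [->|[-> ->]]; rewrite ?eqxx // eq_sym (negPf ca).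
  have /SP[ik0 jk0] : k0 \in S by rewrite k0P inE.
  exists k0; first by rewrite ik0.
  apply/ffunP => l; rewrite ffunE; case: eqVneq => [->//|lk0].
  have : l \notin S by rewrite k0P inE.
  by rewrite inE negbK => /eqP.
have up_uniq : uniq [seq up k | k in [pred k | i k == a]].
  by rewrite map_inj_in_uniq ?enum_uniq // => k l; rewrite !mem_enum; apply: up_inj.
move=> sum0; rewrite -[RHS]sum0 [RHS](bigID (mem [seq up k | k in [pred k | i k == a]])) /=.
rewrite [X in _ = _ + X]big1 ?addr0 => [|j jP]; last first.
  apply/eqP; apply: contraNT jP => /upE[k ik ->].
  by apply/fintype.imageP; exists k.
rewrite -(big_uniq _ up_uniq) big_image; apply: eq_bigr => k /eqP ik.
rewrite [tpow_coef _ _ _]big1 ?mul1r // => l _; rewrite ffunE gE.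
by case: (eqVneq l k) => [->|_]; rewrite ?ik ?eqxx ?orbT.
Qed.

End HighestWeight.

(** * The representation of the symmetric group on M(0) *)

Lemma left_mul_specht (F : fieldType) (n : nat) (eta : seq nat) (s : 'S_n)
    (x : group_alg F n) : x \in specht F n eta -> left_mul s x \in specht F n eta.
Proof.
move=> xS; have : (linfun (@left_mul F n s) @: specht F n eta <= specht F n eta)%VS.
  rewrite {1}/specht limg_span; apply/span_subvP => _ /mapP[_ /fintype.imageP[t _ ->] ->].
  by rewrite lfunE /= left_mulM memv_span //; apply/fintype.imageP; exists (s * t)%g.
by move=> /subvP; apply; rewrite -[left_mul s x]lfunE memv_img.
Qed.

Section ZeroWeightTrace.

Variables (C : numClosedFieldType) (n : nat) (M : {vspace tensor C n}).
Hypothesis M_irr : irreducible_submodule M.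

Let Mu : unitary_stable M. Proof. by case: M_irr. Qed.

Definition zero_weight_ga : {vspace group_alg C n} :=
  (linfun (@ga_tensor C n) @^-1: M)%VS.

Lemma mem_zero_weight_ga x : (x \in zero_weight_ga) = (ga_tensor x \in M).
Proof. by rewrite /zero_weight_ga -memv_preim lfunE. Qed.

Lemma left_mul_zero_weight_ga s x :
  x \in zero_weight_ga -> left_mul s x \in zero_weight_ga.
Proof.
rewrite !mem_zero_weight_ga -tpow_perm_ga_tensor; apply: Mu.
exact: perm_mx_unitary.
Qed.

(* The vectors [t] of [M] such that the zero weight component of [B t] lies in
   the span of the translates of [x], for all [B], form a submodule. *)
Lemma zero_weight_ga_simple x y : x \in zero_weight_ga -> x != 0 ->
  y \in zero_weight_ga -> y \in <<[seq left_mul s x | s : 'S_n]>>%VS.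
Proof.
rewrite !mem_zero_weight_ga => xM x0 yM; set W := <<_>>%VS.
pose P t := t \in M /\ forall B, tensor_ga (tpow B t) \in W.
have [||N NP] := @vspace_of_closed _ _ P.
- by split=> [|B]; rewrite ?mem0v // !linear0 mem0v.
- move=> k u v [uM uW] [vM vW]; split=> [|B]; first by rewrite memvD ?memvZ.
  by rewrite !linearP /= memvD ?memvZ.
have xN : ga_tensor x \in N.
  apply/NP; split=> // B; rewrite tensor_ga_tpow; apply: memv_suml => s _.
  by rewrite memvZ // memv_span //; apply/fintype.imageP; exists s.
have [_ _ M_simple] := M_irr.
have [||N0|NM] := M_simple N.
- by apply/subvP => t /NP[].
- move=> u uu t /NP[tM tW]; apply/NP; split=> [|B]; first exact: Mu.
  by rewrite -tpow_mulmx.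
- move: xN; rewrite N0 memv0 => /eqP x_0; move: x0.
  by rewrite -[x]ga_tensorK x_0 linear0 eqxx.
(* Now [N = M], and the identity matrix returns [y] itself. *)
have /NP[_ /(_ 1%:M)] : ga_tensor y \in N by rewrite NM.
by rewrite -perm_mx1 tpow_perm_ga_tensor ga_tensorK left_mul1.
Qed.

Variable eta : seq nat.
Hypothesis eta_part : is_partition n eta.
Hypothesis M_eta : has_highest_weight eta M.

Let sum_eta : sumn eta = n.
Proof. by case/and3P: eta_part => _ _ /eqP. Qed.

(* Merging the basis vectors along the rows of the diagram turns a highest weight
   vector into a zero weight vector. *)
Lemma zero_weight_ga_generator : exists z, [/\ z \in zero_weight_ga, z != 0,
  {in row_stab n eta, forall p, left_mul p z = z} &
  forall (a : nat) (y : 'I_n), (a < reshape_index eta y)%N ->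
    \sum_(x : 'I_n | reshape_index eta x == a) left_mul (tperm y x) z = - z].
Proof.
have [w [wM w0 w_hw]] := M_eta.
have [i0 i0v i0_card] : exists2 i0 : {ffun 'I_n -> 'I_n},
    forall k, i0 k = reshape_index eta k :> nat &
    forall a, fibre_card a i0 = nth 0%N eta a.
  by exists (row_ffun eta_part) => [k|a]; rewrite ?ffunE // row_ffun_fibre_card.
(* [B0] sends the basis vector [l] to the sum of the basis vectors indexed by the cells of row [l].
   It is singular in general, which calls for stability under all matrices. *)
pose B0 : 'M[C]_n := \matrix_(k, l) (l == i0 k)%:R.
have B0E i : tpow B0 w i = w [ffun k => i0 (i k)].
  rewrite ffunE (bigD1 [ffun k => i0 (i k)]) //= big1 => [|j ji].
    by rewrite /tpow_coef big1 ?mul1r ?addr0 // => k _; rewrite !mxE ffunE eqxx.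
  have [k jik] : exists k, j k != i0 (i k).
    apply/existsP; rewrite -negb_forall; apply: contra ji => /forallP ji.
    by apply/eqP/ffunP => k; rewrite ffunE; apply/eqP.
  by rewrite /tpow_coef (bigD1 k) //= !mxE (negPf jik) !mul0r.
pose z : group_alg C n := [ffun s : 'S_n => w [ffun k => i0 ((s^-1)%g k)]].
exists z; split.
(* [z] encodes the zero weight component of [tpow B0 w], which lies in [M]. *)
- rewrite mem_zero_weight_ga.
  have := unitary_stable_fibre_cards Mu (fun=> 1%N) (enum 'I_n)
    (unitary_stable_tpow Mu B0 wM).
  congr (_ \in M); apply/ffunP => i; rewrite ffunE.
  have [[s ->]|is_] := pselect (exists s, i = perm_ffun s).
    rewrite (_ : all _ _ = true) ?mul1r; last first.
      by apply/allP => a _; rewrite perm_ffun_fibre_card.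
    rewrite B0E ga_tensor_perm ffunE invgK; congr (w _).
    by apply/ffunP => k; rewrite !ffunE.
  rewrite ga_tensor_eq0 => [|s i_s]; last by apply: is_; exists s.
  case: allP => [i1|_]; last by rewrite mul0r.
  case: is_; apply: fibre_card_perm_ffun => a.
  by apply/eqP/i1; rewrite mem_enum.
(* Any index in the support of [w] has the weight of [i0], hence is a rearrangement of it and shows
   up as a coefficient of [z]. *)
- have [j wj] : exists j, w j != 0.
    apply/existsP; rewrite -negb_forall; apply: contra w0 => /forallP w0.
    by apply/eqP/ffunP => j; rewrite ffunE; apply/eqP.
  have [a|s js] := @eq_fibre_card_perm _ j i0.
    by rewrite (hw_support w_hw) ?i0_card.
  apply: contra wj => /eqP/ffunP/(_ s^-1%g); rewrite !ffunE invgK -js.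
  by move=> ->.
- move=> p; rewrite inE => /forallP pR; apply/ffunP => s; rewrite !ffunE.
  congr (w _); apply/ffunP => k; rewrite !ffunE; apply: val_inj.
  by rewrite /= !i0v invMg invgK permM; apply/eqP.
move=> a y ay; apply/ffunP => s; rewrite sum_ffunE ffunE.
have an : (a < n)%N by apply: ltn_trans ay (row_lt_n eta_part y).
(* The raising relation is read at [i0] with the entry of [y] changed to [a]. The term that restores
   [y] is [z]; the others are the exchanges of [y] with the cells of row [a]. *)
pose i1 : {ffun 'I_n -> 'I_n} := [ffun l => if l == y then Ordinal an else i0 l].
pose i' : {ffun 'I_n -> 'I_n} := [ffun k => i1 ((s^-1)%g k)].
have a_neq : Ordinal an != i0 y by rewrite -val_eqE /= i0v ltn_eqF.
have := hw_raise w_hw (i := i') (a := Ordinal an) (c := i0 y).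
rewrite i0v => /(_ ay); rewrite fibre_card_comp_perm -i0v -i0_card.
have -> : (fibre_card (i0 y) i1).+1 = fibre_card (i0 y) i0.
  rewrite [RHS]/fibre_card (cardsD1 y) inE eqxx add1n; congr _.+1.
  apply: eq_card => k; rewrite !inE ffunE.
  by case: (eqVneq k y) => _; rewrite ?(negPf a_neq).
move=> /(_ erefl); rewrite (reindex_inj (@perm_inj _ s)) /= (bigD1 y) /=; last first.
  by rewrite !ffunE permK eqxx.
rewrite (_ : finfun _ = [ffun k => i0 ((s^-1)%g k)]); last first.
  apply/ffunP => k; rewrite !ffunE -(inj_eq (@perm_inj _ s^-1%g) k) permK.
  by case: eqP => [->|].
move/eqP; rewrite addrC addr_eq0 => /eqP sumE.
rewrite [z s]ffunE -sumE; apply: eq_big => [x|x xa].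
  rewrite !ffunE permK; case: (eqVneq x y) => [->|_]; rewrite ?andbF ?andbT.
    by rewrite gtn_eqF.
  by rewrite -val_eqE /= i0v.
have xy : x != y by apply: contraTneq xa => ->; rewrite gtn_eqF.
rewrite !ffunE; congr (w _); apply/ffunP => k; rewrite !ffunE invMg !tpermV permM.
rewrite -(inj_eq (@perm_inj _ s^-1%g) k) permK.
case: tpermP => [->|->|/eqP/negPf ky /eqP/negPf kx].
- by rewrite eq_sym (negPf xy) eqxx; apply: val_inj; rewrite /= i0v (eqP xa).
- by rewrite eqxx.
- by rewrite ky kx.
Qed.

Lemma trace_on_zero_weight (E : 'S_n -> C) (f : tensor C n -> tensor C n) :
  (forall x, f (ga_tensor x) = ga_tensor (\sum_(s : 'S_n) E s *: left_mul s x)) ->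
  trace_on (M :&: zero_weight C n)%VS f = \sum_(s : 'S_n) chi C eta s * E s.
Proof.
move=> fE; have [z [zW z0 z_row z_raise]] := zero_weight_ga_generator.
have bz0 := col_alt_mul_neq0 sum_eta z_row z_raise z0.
have [cz0 z_inj] := young_mul_fixed sum_eta z_row bz0.
set W := zero_weight_ga.
have mulW x : ga_mul x z \in W.
  by apply: memv_suml => s _; rewrite memvZ // left_mul_zero_weight_ga.
(* Right multiplication by [z] is onto because [W] is spanned by the translates of [c z]. *)
have spechtW : (linfun (ga_mulr z) @: specht C n eta)%VS = W.
  apply/eqP; rewrite eqEsubv; apply/andP; split.
    by apply/subvP => _ /memv_imgP[x _ ->]; rewrite lfunE; apply: mulW.
  apply/subvP => y yW; have := zero_weight_ga_simple (mulW _) cz0 yW.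
  apply: subvP; apply/span_subvP => _ /fintype.imageP[s _ ->].
  rewrite -ga_mul_left_mul; apply/memv_imgP.
  exists (left_mul s (young_symmetrizer C n eta)); last by rewrite lfunE.
  by rewrite memv_span //; apply/fintype.imageP; exists s.
have MW : (linfun (@ga_tensor C n) @: W)%VS = (M :&: zero_weight C n)%VS.
  apply/eqP; rewrite eqEsubv; apply/andP; split; apply/subvP => t.
    move=> /memv_imgP[x xW ->]; rewrite lfunE /= memv_cap -mem_zero_weight_ga xW.
    by rewrite -limg_ga_tensor; apply/memv_imgP; exists x; rewrite ?memvf ?lfunE.
  rewrite memv_cap -limg_ga_tensor => /andP[tM /memv_imgP[x _ tx]].
  by rewrite tx memv_img // mem_zero_weight_ga -[ga_tensor x]lfunE -tx.
have left_mul_sum x : \sum_(s : 'S_n) E s *: left_mul s x =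
    (\sum_(s : 'S_n) E s *: linfun (@left_mul C n s))%VF x.
  rewrite sum_lfunE; apply: eq_bigr => s _.
  by rewrite scale_lfunE lfunE.
(* The trace is transported twice: from M(0) to [W] along [ga_tensor], then, for each [s], from [W]
   to the Specht module. *)
rewrite -MW (trace_on_lfun_iso (f := (\sum_(s : 'S_n) E s *: linfun (@left_mul C n s))%VF)).
- rewrite (eq_in_trace_on (g := fun x => \sum_(s : 'S_n) E s *: left_mul s x)) //.
  rewrite trace_on_suml; apply: eq_bigr => s _; rewrite mulrC; congr (_ * _).
  rewrite -spechtW (trace_on_lfun_iso (f := linfun (@left_mul C n s))).
  + by apply: eq_in_trace_on => x _; rewrite lfunE.
  + apply/eqP; rewrite -subv0; apply/subvP => x; rewrite memv_cap memv_ker lfunE /=.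
    by move=> /andP[xS /eqP /(z_inj _ xS) ->]; rewrite mem0v.
  + by move=> x xS; rewrite lfunE; apply: left_mul_specht.
  + by move=> x _; rewrite !lfunE /= /ga_mulr ga_mul_left_mul.
- apply/eqP; rewrite -subv0; apply/subvP => x; rewrite memv_cap memv_ker lfunE /=.
  by move=> /andP[_ /eqP x0]; rewrite -[x]ga_tensorK x0 linear0 mem0v.
- move=> x xW; rewrite -left_mul_sum; apply: memv_suml => s _.
  by rewrite memvZ // left_mul_zero_weight_ga.
- by move=> x _; rewrite !lfunE /= fE left_mul_sum.
Qed.

End ZeroWeightTrace.

(** * Haar integrals *)

Section HaarIntegral.

Local Open Scope classical_set_scope.
Local Open Scope complex_scope.

Variables (R : realType) (n : nat).
Local Notation U := (unitary_borel R n).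
Local Notation Re := complex.Re.
Local Notation Im := complex.Im.

Lemma normc_ge_Im (x : R[i]) : `|Im x|%:C <= `|x|.
Proof.
case: x => a b; rewrite normc_def lecR /= -sqrtr_sqr ler_wsqrtr //.
by rewrite lerDr sqr_ge0.
Qed.

(** A class closed under sums, products and conjugation that guarantees integrability for a
    probability measure. *)
Definition mbounded (f : U -> R[i]) : Prop :=
  [/\ measurable_fun setT (fun u => Re (f u)), measurable_fun setT (fun u => Im (f u)) &
      exists K : R, forall u, `|f u| <= K%:C].

Lemma mbounded_cst (c : R[i]) : mbounded (fun=> c).
Proof.
split; [exact: measurable_cst|exact: measurable_cst|].
by exists (Re `|c|) => _; rewrite RRe_real ?normr_real.
Qed.

Lemma mboundedD f g : mbounded f -> mbounded g -> mbounded (fun u => f u + g u).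
Proof.
move=> [fr fi [K fK]] [gr gi [L gL]]; split.
- under eq_fun do rewrite raddfD; exact: measurable_funD.
- under eq_fun do rewrite raddfD; exact: measurable_funD.
- by exists (K + L) => u; rewrite rmorphD (le_trans (ler_normD _ _)) ?lerD.
Qed.

Lemma mboundedM f g : mbounded f -> mbounded g -> mbounded (fun u => f u * g u).
Proof.
move=> [fr fi [K fK]] [gr gi [L gL]]; split.
- rewrite (_ : (fun u => _) = (fun u => Re (f u) * Re (g u) - Im (f u) * Im (g u))).
    by apply: measurable_funB; apply: measurable_funM.
  by apply/funext => u; case: (f u) => a b; case: (g u).
- rewrite (_ : (fun u => _) = (fun u => Re (f u) * Im (g u) + Im (f u) * Re (g u))).
    by apply: measurable_funD; apply: measurable_funM.
  by apply/funext => u; case: (f u) => a b; case: (g u).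
- by exists (K * L) => u; rewrite rmorphM normrM ler_pM.
Qed.

Lemma mbounded_conj f : mbounded f -> mbounded (fun u => (f u)^*%C).
Proof.
move=> [fr fi [K fK]]; split.
- by rewrite (_ : (fun u => _) = (fun u => Re (f u))) //; apply/funext => u; case: (f u).
- rewrite (_ : (fun u => _) = (fun u => - Im (f u))); first exact: measurable_funN.
  by apply/funext => u; case: (f u).
- by exists K => u; rewrite -[_^*%C]/(_^*)%R norm_conjC.
Qed.

Lemma mbounded_sum (I : Type) (r : seq I) (f : I -> U -> R[i]) :
  (forall i, mbounded (f i)) -> mbounded (fun u => \sum_(i <- r) f i u).
Proof.
move=> fb; elim: r => [|i r IHr].
  by under eq_fun do rewrite big_nil; exact: mbounded_cst.
by under eq_fun do rewrite big_cons; exact: mboundedD.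
Qed.

Lemma mbounded_prod (I : Type) (r : seq I) (f : I -> U -> R[i]) :
  (forall i, mbounded (f i)) -> mbounded (fun u => \prod_(i <- r) f i u).
Proof.
move=> fb; elim: r => [|i r IHr].
  by under eq_fun do rewrite big_nil; exact: mbounded_cst.
by under eq_fun do rewrite big_cons; exact: mboundedM.
Qed.

(** A 1-Lipschitz [h] is continuous, so preimages of open intervals are open in the induced topology
    and hence Borel. It serves for real and imaginary parts. *)
Lemma continuous_borel_measurable (h : R[i]^o -> R) (i j : 'I_n) :
  (forall x y : R[i], (`|h x - h y|%:C <= `|x - y|)%R) ->
  measurable_fun setT (fun u : U => h (unitary_val u i j)).
Proof.
move=> h_lip.
have h_cont : continuous h.
  move=> x A /= /(nbhs_ballP (h x))[e e0 eA]; apply/nbhs_ballP.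
  exists (e%:C : R[i]) => /= [|y xy]; first by rewrite ltcR.
  by apply: eA; rewrite -ball_normE /= -ltcR; apply: le_lt_trans (h_lip x y) xy.
have u_cont : continuous (fun u : initial_topology (@unitary_val R n) => h (unitary_val u i j)).
  move=> u; apply: continuous_comp; last exact: h_cont.
  apply: (@continuous_comp (initial_topology (@unitary_val R n)) 'M[R[i]^o]_n R[i]^o
    (@unitary_val R n) (fun M => M i j) u).
    exact: initial_continuous.
  exact: coord_continuous.
apply: (measurability _ (RGenOpens.measurableE R)).
move=> _ [_ [a [b ->] <-]]; rewrite setTI; apply: sub_sigma_algebra.
move/continuousP: u_cont; apply; exact: interval_open.
Qed.

Lemma mbounded_entry (i j : 'I_n) : mbounded (fun u => unitary_val u i j).
Proof.
split.
- apply: continuous_borel_measurable => x y; rewrite -raddfB; exact: normc_ge_Re.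
- apply: continuous_borel_measurable => x y; rewrite -raddfB; exact: normc_ge_Im.
(* The rows of a unitary matrix have norm one, which bounds each entry. *)
exists 1 => u; have /unitarymxP/matrixP/(_ i i) := unitary_valP u.
rewrite !mxE eqxx mulr1n => uu.
rewrite rmorph1 -(expr_le1 (n := 2)) // -uu (bigD1 j) //= !mxE -normCK lerDl.
by apply: sumr_ge0 => k _; rewrite !mxE mul_conjC_ge0.
Qed.

Lemma mbounded_conj_by (A : 'M[R[i]]_n) (i j : 'I_n) :
  mbounded (fun u => conj_by A (unitary_val u) i j).
Proof.
under eq_fun do rewrite mxE; apply: mbounded_sum => k; apply: mboundedM.
  under eq_fun do rewrite mxE; apply: mbounded_sum => l.
  by apply: mboundedM; [exact: mbounded_entry|exact: mbounded_cst].
under eq_fun do rewrite !mxE; apply: mbounded_conj; exact: mbounded_entry.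
Qed.

Variable mu : probability U R.

Lemma mbounded_integrable f : mbounded f ->
  mu.-integrable setT (EFin \o (fun u => Re (f u))) /\
  mu.-integrable setT (EFin \o (fun u => Im (f u))).
Proof.
have muT : (mu setT < +oo)%E by apply: le_lt_trans (probability_le1 mu measurableT) (ltry 1).
move=> [fr fi [K fK]]; split; apply: measurable_bounded_integrable => //.
- exists K; split; rewrite ?num_real // => x Kx u _ /=.
  by apply: le_trans (ltW Kx); rewrite -lecR (le_trans (normc_ge_Re _)).
- exists K; split; rewrite ?num_real // => x Kx u _ /=.
  by apply: le_trans (ltW Kx); rewrite -lecR (le_trans (normc_ge_Im _)).
Qed.

Lemma integralCD f g : mbounded f -> mbounded g ->
  integralC mu (fun u => f u + g u) = integralC mu f + integralC mu g.
Proof.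
move=> /mbounded_integrable[fr fi] /mbounded_integrable[gr gi].
rewrite /integralC.
under eq_Rintegral do rewrite raddfD /=; rewrite RintegralD //.
under [X in _ +i* X]eq_Rintegral do rewrite raddfD /=; by rewrite RintegralD.
Qed.

Lemma integralCZ (c : R[i]) f : mbounded f ->
  integralC mu (fun u => c * f u) = c * integralC mu f.
Proof.
move=> /mbounded_integrable[fr fi]; case: c => a b; rewrite /integralC.
have intZ h r : mu.-integrable setT (EFin \o h) ->
    mu.-integrable setT (EFin \o (fun u => r * h u)).
  by move=> inth; apply: (eq_integrable measurableT) (integrableZl measurableT r inth).
rewrite (_ : (fun u => Re _) = fun u => a * Re (f u) - b * Im (f u)); last first.
  by apply/funext => u; case: (f u).
rewrite (_ : (fun u => Im _) = fun u => a * Im (f u) + b * Re (f u)); last first.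
  by apply/funext => u; case: (f u).
rewrite RintegralB ?RintegralD ?RintegralZl //; try exact: intZ.
Qed.

Lemma integralC_suml (I : finType) (c : I -> R[i]) (f : I -> U -> R[i]) :
  (forall i, mbounded (f i)) ->
  integralC mu (fun u => \sum_i c i * f i u) = \sum_i c i * integralC mu (f i).
Proof.
move=> fb; elim: (index_enum I) => [|i r IHr].
  rewrite big_nil -[RHS](mul0r (integralC mu (fun=> 0))) -integralCZ; last exact: mbounded_cst.
  by congr integralC; apply/funext => u; rewrite big_nil mul0r.
rewrite big_cons -IHr -integralCZ // -integralCD.
- by congr integralC; apply/funext => u; rewrite big_cons.
- by apply: mboundedM => //; exact: mbounded_cst.
- by apply: mbounded_sum => k; apply: mboundedM => //; exact: mbounded_cst.
Qed.

Hypothesis mu_haar : is_haar mu.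

(** Invariance says that [f] and its translate push [mu] forward to the same measure on the line. *)
Lemma Rintegral_haar (g : unitary R n) (f : U -> R) :
  measurable_fun setT f -> measurable_fun setT (fun u : U => f (unitary_mul g u)) ->
  mu.-integrable setT (EFin \o f) ->
  mu.-integrable setT (EFin \o (fun u : U => f (unitary_mul g u))) ->
  Rintegral mu setT (fun u : U => f (unitary_mul g u)) = Rintegral mu setT f.
Proof.
move=> mf mfg intf intfg; rewrite /Rintegral; congr fine.
pose id_ (r : measurableTypeR R) : \bar R := r%:E.
have idm : measurable_fun setT id_ by exact/measurable_EFinP/measurable_id.
transitivity (\int[pushforward mu (fun u : U => f (unitary_mul g u))]_(r in setT) id_ r)%E.
  by rewrite integral_pushforward.
transitivity (\int[pushforward mu f]_(r in setT) id_ r)%E; last first.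
  by rewrite integral_pushforward.
apply: eq_measure_integral => B mB _; rewrite /pushforward.
by apply: (mu_haar g (S := f @^-1` B)); rewrite -[_ @^-1` _]setTI; apply: mf.
Qed.

Lemma integralC_haar (g : unitary R n) (f : U -> R[i]) :
  mbounded f -> mbounded (fun u : U => f (unitary_mul g u)) ->
  integralC mu (fun u : U => f (unitary_mul g u)) = integralC mu f.
Proof.
move=> fb fgb; have [fr fi] := mbounded_integrable fb.
have [fgr fgi] := mbounded_integrable fgb.
case: fb fgb => mr mi _ [mgr mgi _].
rewrite /integralC; congr (_ +i* _).
  exact: (@Rintegral_haar g (fun u => Re (f u))).
exact: (@Rintegral_haar g (fun u => Im (f u))).
Qed.

End HaarIntegral.

(** * Averaging *)

(** A self-map of a finite set that attains every value is a permutation. *)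
Lemma missed_value (n : nat) (i : {ffun 'I_n -> 'I_n}) :
  (forall s, i <> perm_ffun s) -> exists a, fibre_card a i = 0%N.
Proof.
move=> i_perm; apply: contrapT => i_onto.
have /fin_all_exists[g ig] a : exists k, i k = a.
  have : (0 < fibre_card a i)%N.
    by rewrite lt0n; apply/eqP => ia; apply: i_onto; exists a.
  by rewrite card_gt0 => /set0Pn[k]; rewrite inE => /eqP; exists k.
have g_inj : injective g by move=> a b ab; rewrite -(ig a) ab ig.
apply: (i_perm (perm g_inj)^-1%g); apply/ffunP => k; rewrite ffunE.
rewrite -{1}[k](permKV (perm g_inj)).
by rewrite permE ig.
Qed.

Section AveragedTensorPower.

Local Open Scope complex_scope.

Variables (R : realType) (n : nat) (mu : probability (unitary_borel R n) R).
Hypothesis mu_haar : is_haar mu.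
Variable A : 'M[R[i]]_n.

Lemma mbounded_tpow_coef (i j : {ffun 'I_n -> 'I_n}) :
  mbounded (fun u : unitary_borel R n => tpow_coef (conj_by A (unitary_val u)) i j).
Proof. by apply: mbounded_prod => k; apply: mbounded_conj_by. Qed.

(* Translating by the diagonal unitary with entry -1 at a value missed by [i]
   changes the sign of the integrand. *)
Lemma integralC_tpow_coef_eq0 (i : {ffun 'I_n -> 'I_n}) (r : 'S_n) :
  (forall s, i <> perm_ffun s) ->
  integralC mu (fun u => tpow_coef (conj_by A (unitary_val u)) i (perm_ffun r)) = 0.
Proof.
move=> /missed_value[a ia].
pose d : 'rV[R[i]]_n := \row_b (if b == a then -1 else 1).
have dd b : d 0 b * (d 0 b)^* = 1.
  by rewrite mxE; case: ifP => _; rewrite ?rmorphN rmorph1 ?mulrNN mulr1.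
have d_unitary : (diag_mx d : 'M[R[i]]_n) \is unitarymx.
  apply/unitarymxP; rewrite tr_diag_mx map_diag_mx mul_diag_mx; apply/matrixP => b c.
  rewrite !mxE; case: (eqVneq b c) => [->|_]; rewrite ?mulr1n ?mulr0n ?mulr0 //.
  by have := dd c; rewrite mxE.
pose g : unitary R n :=
  Unitary (d_unitary : ((diag_mx d : 'M[R[i]^o]_n) : 'M[R[i]]_n) \is unitarymx).
set f := fun u => _.
have fg u : f (unitary_mul g u) = -1 * f u.
  have conjE : conj_by A (unitary_mul g u) =
      diag_mx d *m conj_by A (unitary_val u) *m diag_mx d.
    rewrite /conj_by trmx_mul map_mxM tr_diag_mx map_diag_mx !mulmxA.
    congr (_ *m diag_mx _); apply/rowP => b; rewrite !mxE.
    by case: ifP => _; rewrite ?rmorphN rmorph1.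
  rewrite /f conjE /tpow_coef; move: (conj_by _ _) => X.
  under eq_bigr do rewrite mul_mx_diag mul_diag_mx !mxE.
  rewrite !big_split /= mulrAC; congr (_ * _).
  have dE b : (if b == a then -1 else 1) = d 0 b by rewrite mxE.
  under eq_bigr do rewrite dE; under [X in _ * X]eq_bigr do rewrite dE.
  (* The index [i] misses [a] and contributes no sign, while the permutation takes the value [a]
     exactly once. *)
  rewrite !(prod_fibre_card (fun b => d 0 b)) -big_split (bigD1 a) //= big1 => [|b ba].
    by rewrite ia perm_ffun_fibre_card mxE eqxx mul1r expr1 mulr1.
  by rewrite mxE (negPf ba) !expr1n mulr1.
have fb : mbounded f := mbounded_tpow_coef i (perm_ffun r).
have fgb : mbounded (fun u : unitary_borel R n => f (unitary_mul g u)).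
  under eq_fun do rewrite fg; apply: mboundedM => //; exact: mbounded_cst.
have := integralC_haar mu_haar fb fgb.
rewrite (_ : (fun u => f (unitary_mul g u)) = fun u => -1 * f u); last exact/funext.
rewrite integralCZ // mulN1r => /eqP; rewrite eq_sym -addr_eq0 -mulr2n mulrn_eq0 /=.
by move/eqP.
Qed.

(** The kernel formula computes the zero weight part of the image; the other components vanish by
    the sign argument. *)
Lemma averaged_tpow_ga_tensor (x : group_alg R[i] n) :
  averaged_tpow mu A (ga_tensor x) =
  ga_tensor (\sum_(s : 'S_n)
    integralC mu (fun u => \prod_k (conj_by A (unitary_val u)) k (s k)) *: left_mul s x).
Proof.
rewrite -(tensor_ga_kernel (c := fun i j =>
  integralC mu (fun u => tpow_coef (conj_by A (unitary_val u)) i j))).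
  rewrite tensor_gaK // => i i_perm; rewrite ffunE big1 // => j _.
  have [[r ->]|j_perm] := pselect (exists r, j = perm_ffun r).
    by rewrite integralC_tpow_coef_eq0 ?mul0r.
  by rewrite ga_tensor_eq0 ?mulr0 // => r jr; apply: j_perm; exists r.
by move=> s r; congr integralC; apply/funext => u; rewrite tpow_coef_perm.
Qed.

Lemma averaged_immanantE (eta : seq nat) :
  averaged_immanant mu eta A = \sum_(s : 'S_n) chi R[i] eta s *
    integralC mu (fun u => \prod_k (conj_by A (unitary_val u)) k (s k)).
Proof.
rewrite -integralC_suml // => s.
by apply: mbounded_prod => k; apply: mbounded_conj_by.
Qed.

End AveragedTensorPower.

Theorem theorem5 (R : realType) (n : nat) (hn : (1 <= n)%N) (eta : seq nat)
    (heta : is_partition n eta) (A : 'M[R[i]%type]_n)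
    (mu : probability (unitary_borel R n) R) (hmu : is_haar mu)
    (M : {vspace tensor R[i]%type n})
    (M_irr : irreducible_submodule M) (M_eta : has_highest_weight eta M) :
  trace_on (M :&: zero_weight R[i]%type n)%VS (averaged_tpow mu A)
    = averaged_immanant mu eta A.
Proof.
rewrite averaged_immanantE.
exact/trace_on_zero_weight/averaged_tpow_ga_tensor.
Qed.
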